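(* Let $p,q\le -1$ be integers such that either $pq>4$ or $p=q=-2$, and let $\mu_{p,q}:\mathbb{CP}^2\dashrightarrow\mathbb{CP}^2$ be the birational map given in affine coordinates by $$\mu_{p,q}=\mu^{(2)}_{p,q}\circ\mu^{(1)}_{p,q},\qquad \mu^{(1)}_{p,q}(x,y)=\left(\frac{1+y^q}{x},\,y\right),\qquad \mu^{(2)}_{p,q}(x,y)=\left(x,\,\frac{1+x^p}{y}\right).$$ Then $\mu_{p,q}$ does not preserve an invariant fibration.
   Context: Everything is over $\mathbb{C}$, and $\mathbb{C}^2\subset\mathbb{CP}^2$ via $(x,y)\mapsto[x:y:1]$. For a birational self-map $f:X\dashrightarrow X$ of a projective algebraic surface, an invariant fibration is a triple $(Y,\rho,g)$ where $Y$ is a projective curve, $\rho:X\dashrightarrow Y$ is a dominant rational map and $g:Y\to Y$ is a regular map such that $\rho\circ f=g\circ\rho$ at each point where the compositions are defined. (Generic fibers of $\rho$ are not required to be irreducible.) *)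

(* Defs.v *)
From mathcomp Require Import all_boot all_order all_algebra.
From mathcomp Require Import complex classical_sets reals mpoly zify ring.

Set Implicit Arguments.
Unset Strict Implicit.
Unset Printing Implicit Defensive.

Import GRing.Theory.
Local Open Scope ring_scope.
Local Open Scope classical_set_scope.

Section ProjectiveGeometry.
Variable K : closedFieldType.

(* P^n(K), as the set of lines of K^(n+1). *)
Definition projspace (n : nat) : Type :=
  {L : {vspace 'rV[K]_n.+1} | \dim L == 1%N}.

Definition proj_point (n : nat) (v : 'rV[K]_n.+1) (v_neq0 : v != 0) :
    projspace n :=
  exist _ <[v]>%VS (introT eqP (etrans (dim_vline v) (f_equal nat_of_bool v_neq0))).

Definition vanishes_at (n : nat) (h : {mpoly K[n.+1]}) (L : projspace n) :=
  forall v, v \in sval L -> h.@[v 0] = 0.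

Definition zariski_closed (n : nat) (Z : set (projspace n)) : Prop :=
  exists2 S : set {mpoly K[n.+1]},
    (forall h, S h -> exists d, h \is d.-homog) &
    Z = [set L | forall h, S h -> vanishes_at h L].

Definition irreducible_closed (n : nat) (Z : set (projspace n)) : Prop :=
  [/\ zariski_closed Z, Z !=set0 &
      forall A B, zariski_closed A -> zariski_closed B ->
        Z `<=` A `|` B -> Z `<=` A \/ Z `<=` B].

Definition irreducible_chain (n : nat) (Y : set (projspace n)) (d : nat)
    (Z : nat -> set (projspace n)) : Prop :=
  (forall i, (i <= d)%N -> irreducible_closed (Z i) /\ Z i `<=` Y) /\
  (forall i, (i < d)%N -> Z i `<` Z i.+1).

Definition krull_dim (n : nat) (Y : set (projspace n)) (d : nat) : Prop :=
  (exists Z, irreducible_chain Y d Z) /\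
  ~ (exists Z, irreducible_chain Y d.+1 Z).

(* Irreducibility is not imposed here; for the target of a dominant rational
   map from P^n it is automatic. *)
Definition projective_curve (n : nat) (Y : set (projspace n)) : Prop :=
  zariski_closed Y /\ krull_dim Y 1.

(* Representative of a rational map P^n --> P^m: an (m+1)-tuple of forms of the
   same degree, not all zero.  The rational map itself is the class of the tuple
   under [ratmap_equiv]. *)
Record ratmap (n m : nat) := RatMap {
  ratmap_deg : nat;
  ratmap_form :> 'I_m.+1 -> {mpoly K[n.+1]};
  ratmap_homog : forall i, ratmap_form i \is ratmap_deg.-homog;
  ratmap_neq0 : exists i, ratmap_form i != 0
}.

Definition ratmap_equiv (n m : nat) (F G : ratmap n m) : Prop :=
  forall i j, F i * G j = F j * G i.

Definition ratmap_eval (n m : nat) (F : ratmap n m) (v : 'rV[K]_n.+1) :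
    'rV[K]_m.+1 :=
  \row_i (F i).@[v 0].

(* The forms of this very tuple do not all vanish at L, and they send L to M. *)
Definition tuple_maps (n m : nat) (F : ratmap n m)
    (L : projspace n) (M : projspace m) : Prop :=
  exists v, [/\ v \in sval L, ratmap_eval F v != 0 &
                ratmap_eval F v \in sval M].

(* The rational map is defined at L, with value M; the domain of definition is
   the maximal one, as any equivalent tuple may be used at L. *)
Definition ratmap_maps (n m : nat) (F : ratmap n m)
    (L : projspace n) (M : projspace m) : Prop :=
  exists2 G : ratmap n m, ratmap_equiv F G & tuple_maps G L M.

Definition dominant_onto (n m : nat) (F : ratmap n m)
    (Y : set (projspace m)) : Prop :=
  (forall L M, ratmap_maps F L M -> Y M) /\
  (forall Z, zariski_closed Z ->
     (forall L M, ratmap_maps F L M -> Z M) -> Y `<=` Z).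

(* g : Y -> Y is a morphism: Zariski-locally on Y it is given by tuples of forms
   of the same degree.  The values of g outside Y are irrelevant. *)
Definition regular_self_map (n : nat) (Y : set (projspace n))
    (g : projspace n -> projspace n) : Prop :=
  (forall y, Y y -> Y (g y)) /\
  (forall y, Y y -> exists G : ratmap n n,
     tuple_maps G y (g y) /\
     (forall z w, Y z -> tuple_maps G z w -> g z = w)).

Definition invariant_fibration (n N : nat) (f : ratmap n n)
    (Y : set (projspace N)) (rho : ratmap n N)
    (g : projspace N -> projspace N) : Prop :=
  [/\ projective_curve Y,
      dominant_onto rho Y,
      regular_self_map Y g &
      forall L M A B, ratmap_maps f L M -> ratmap_maps rho M A ->
        ratmap_maps rho L B -> A = g B].

Definition preserves_invariant_fibration (n : nat) (f : ratmap n n) : Prop :=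
  exists (N : nat) (Y : set (projspace N)) (rho : ratmap n N)
         (g : projspace N -> projspace N),
    invariant_fibration f Y rho g.

End ProjectiveGeometry.

Section Mutations.
Variable K : closedFieldType.

Definition affine_row (a : K * K) : 'rV[K]_3 :=
  \row_i [:: a.1; a.2; 1]`_i.

Fact affine_row_neq0 a : affine_row a != 0.
Proof.
apply/eqP => /rowP /(_ (Ordinal (isT : 2 < 3)%N)).
by rewrite !mxE; apply/eqP; rewrite oner_eq0.
Qed.

Definition affine_point (a : K * K) : projspace K 2 :=
  proj_point (affine_row_neq0 a).

Definition mu1 (q : int) (a : K * K) : K * K := ((1 + a.2 ^ q) / a.1, a.2).

Definition mu2 (p : int) (a : K * K) : K * K := (a.1, (1 + a.1 ^ p) / a.2).

Definition in_torus (a : K * K) : Prop := a.1 != 0 /\ a.2 != 0.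

(* F is the rational self-map of P^2 given in affine coordinates by
   mu2 p \o mu1 q.  As division by zero is total in MathComp, the formula is
   imposed exactly at the points where, for p, q < 0, no denominator of mu1 q at
   a, nor of mu2 p at mu1 q a, vanishes; these points are Zariski dense, so F is
   determined up to [ratmap_equiv].  See [mutation_exists]. *)
Definition is_mutation (p q : int) (F : ratmap K 2 2) : Prop :=
  forall a : K * K, in_torus a -> in_torus (mu1 q a) ->
    ratmap_maps F (affine_point a) (affine_point (mu2 p (mu1 q a))).

(* [is_mutation p q] is not vacuous.  The forms used are, for P = - p and
   Q = - q, mu1 : [x : y : z] |-> [(y^Q + z^Q) z^2 : x y^(Q+1) : x y^Q z] followed
   by mu2 : [x : y : z] |-> [x^(P+1) y : (x^P + z^P) z^2 : x^P y z]. *)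
Lemma mutation_exists (p q : int) :
  p <= -1 -> q <= -1 -> exists F : ratmap K 2 2, is_mutation p q F.
Proof.
case: p => [//|P]; case: q => [//|Q] _ _.
pose x : {mpoly K[3]} := 'X_(inord 0).
pose y : {mpoly K[3]} := 'X_(inord 1).
pose z : {mpoly K[3]} := 'X_(inord 2).
have hX (i : 'I_3) : ('X_i : {mpoly K[3]}) \is 1.-homog by rewrite dhomogX; apply/eqP; exact: mdeg1.
have hXn (i : 'I_3) k : ('X_i : {mpoly K[3]}) ^+ k \is k.-homog.
  by have := dhomogMn k (hX i); rewrite mul1n.
pose A := (y ^+ Q.+1 + z ^+ Q.+1) * z ^+ 2.
pose B := x * y ^+ Q.+2.
pose D := x * y ^+ Q.+1 * z.
have hA : A \is (Q.+3).-homog.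
  by have := dhomogM (dhomogD (hXn (inord 1) Q.+1) (hXn (inord 2) Q.+1))
    (hXn (inord 2) 2); rewrite addn2.
have hB : B \is (Q.+3).-homog.
  by have := dhomogM (hX (inord 0)) (hXn (inord 1) Q.+2); rewrite add1n.
have hD : D \is (Q.+3).-homog.
  have := dhomogM (dhomogM (hX (inord 0)) (hXn (inord 1) Q.+1)) (hX (inord 2)).
  by rewrite add1n addn1.
have hp (h : {mpoly K[3]}) k : h \is (Q.+3).-homog ->
    h ^+ k \is (Q.+3 * k).-homog by exact: dhomogMn.
pose u (i : 'I_3) := [:: A ^+ P.+2 * B; (A ^+ P.+1 + D ^+ P.+1) * D ^+ 2;
  A ^+ P.+1 * B * D]`_i.
have hcast (h : {mpoly K[3]}) d d' : h \is d.-homog -> d = d' -> h \is d'.-homog.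
  by move=> ? <-.
have hu i : u i \is (Q.+3 * P.+3).-homog.
  case: i => [[|[|[|//]]]] ? /=; rewrite /u /=.
  - by apply: hcast (dhomogM (hp _ P.+2 hA) hB) _; lia.
  - apply: hcast (dhomogM (dhomogD (hp _ P.+1 hA) (hp _ P.+1 hD)) (hp _ 2 hD)) _.
    by lia.
  - by apply: hcast (dhomogM (dhomogM (hp _ P.+1 hA) hB) hD) _; lia.
have ev a : [/\ x.@[affine_row a 0] = a.1, y.@[affine_row a 0] = a.2 &
    z.@[affine_row a 0] = 1].
  by split; rewrite mevalXU mxE inordK.
have u_neq0 : exists i, u i != 0.
  have nz (i : 'I_3) : ('X_i : {mpoly K[3]}) != 0.
    apply/eqP => /(congr1 (meval (fun=> 1))); rewrite mevalXU meval0.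
    by apply/eqP; rewrite oner_eq0.
  exists (inord 0); rewrite /u inordK //= mulf_neq0 //; last first.
    by rewrite mulf_neq0 ?expf_neq0 //; exact: nz.
  rewrite expf_neq0 // mulf_neq0 //; last by rewrite expf_neq0 //; exact: nz.
  apply/eqP => /(congr1 (meval (affine_row (0, 0) 0))).
  have [_ yE zE] := ev (0, 0).
  rewrite mevalD !rmorphXn /= yE zE meval0 expr1n expr0n /= add0r.
  by apply/eqP; rewrite oner_eq0.
exists (RatMap hu u_neq0) => -[a b] [/= a0 b0] [/= c0 _].
exists (RatMap hu u_neq0); first by move=> i j; rewrite mulrC.
have [xE yE zE] := ev (a, b); rewrite /= in xE yE zE.
move: c0; rewrite /mu2 /mu1 /=; set c := (1 + b ^ Negz Q) / a => c0.
have AE : A.@[affine_row (a, b) 0] = c * (a * b ^+ Q.+1).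
  rewrite /A mevalM mevalD !rmorphXn /= yE zE !expr1n mulr1 /c.
  by rewrite NegzE -exprnN mulrA divfK // mulrDl mul1r mulVf ?expf_neq0.
have BE : B.@[affine_row (a, b) 0] = b * (a * b ^+ Q.+1).
  by rewrite /B mevalM !rmorphXn /= xE yE exprS mulrCA.
have DE : D.@[affine_row (a, b) 0] = a * b ^+ Q.+1.
  by rewrite /D !mevalM !rmorphXn /= xE yE zE mulr1.
set t := a * b ^+ Q.+1 in AE BE DE.
have t0 : t != 0 by apply: mulf_neq0 => //; exact: expf_neq0.
clearbody c t A B D.
pose s := c ^+ P.+1 * b * t ^+ P.+3.
have s0 : s != 0.
  by apply: mulf_neq0; [apply: mulf_neq0 => // |]; exact: expf_neq0.
have uE : ratmap_eval (RatMap hu u_neq0) (affine_row (a, b)) =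
    s *: affine_row (c, (1 + c ^ Negz P) / b).
  apply/rowP => -[[|[|[|//]]]] ?; rewrite !mxE /u /=.
  - rewrite mevalM rmorphXn /= AE BE /s exprMn !(exprS c) !(exprS t).
    by ring.
  - rewrite mevalM mevalD !rmorphXn /= AE DE /s NegzE -exprnN.
    have cP0 : c ^+ P.+1 != 0 by rewrite expf_neq0.
    move: cP0; rewrite exprMn; set e := c ^+ P.+1 => e0.
    by rewrite !(exprS t); field; rewrite e0 b0.
  - rewrite !mevalM !rmorphXn /= AE BE DE /s exprMn !(exprS t).
    by ring.
exists (affine_row (a, b)); split; first exact: memv_line.
- by rewrite uE scaler_eq0 negb_or s0 affine_row_neq0.
- by rewrite uE memvZ ?memv_line.
Qed.

End Mutations.

(* Main.v *)
Require Import Defs.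
From mathcomp Require Import all_boot all_order all_algebra.
From mathcomp Require Import complex classical_sets reals.
From mathcomp Require Import boolp mpoly zify ring.

Set Implicit Arguments.
Unset Strict Implicit.
Unset Printing Implicit Defensive.

Import Order.TTheory GRing.Theory Num.Theory.
Local Open Scope ring_scope.

(** Let f be the mutation, P = - p and Q = - q.  Two facts about an orbit of f
pull against each other.

Let (Y, rho, g) be an invariant fibration and h a nonconstant ratio of two
components of rho.  As rho o f^N = g^N o rho and Y is a curve, h and h o f^N
satisfy, for every N, a nontrivial polynomial relation with constant
coefficients ([orbit_relation], which rests on [curve_relation]).

On the other hand f contracts the lines y = w with w^Q = -1.  Follow the curve
t |-> (t, w + t^(n+2)), which has contact of order n + 2 with such a line at
t = 0, and record the orders in t of the coordinates of its iterates.  Writing an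
orbit as a sequence z_k with z_(k+1) z_(k-1) = 1 + z_k^(-e), where e is Q or P
according to the parity of k, one term of 1 + z_k^(-e) dominates as soon as z_k
has nonzero order, so that the orders follow a piecewise linear recursion.  When
P Q >= 4 this recursion never meets the order 0 again, in either direction of
time, and every third iterate comes back to the quadrant of orders of signs
(+, -).  The forward order vectors are n + 1 times vectors that do not depend on
n, and the backward ones do not depend on n at all ([critical_forward],
[critical_backward]).  In both sequences the slopes are strictly monotone.
Hence, far along either sequence, every form in the coordinates has a single
monomial of least order, and h minus a suitable constant has an order that is a
nonzero multiple of the scale of the vector ([ratio_order]).

Now fix a far backward iterate b and a far forward iterate f^N(b), and let n
vary.  In the relation between h at b and h at f^N(b), the term of bidegree
(k, l) has order const + k alpha + (n + 1) l beta with fixed nonzero alpha and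
beta.  For n large all these orders are distinct, so that the term of least order
cannot be cancelled ([biform_order_neq0]): a contradiction. *)

(** * Germs of functions of one parameter *)

Section Germs.
Variable K : closedFieldType.
Implicit Types (z w : K -> K) (k l : int) (c : K).

(** Off a finite set of parameters.  Functions are compared only up to such sets,
so that poles, and the conventional value 0 of the inverse of 0, do no harm. *)
Definition almost_all (P : K -> Prop) : Prop :=
  exists2 e : {poly K}, e != 0 & forall t, e.[t] != 0 -> P t.

Lemma almost_all_ex (P : K -> Prop) : almost_all P -> exists t, P t.
Proof.
move=> [e /closed_nonrootP[t et] eP]; exists t; exact: eP.
Qed.

Lemma almost_allT (P : K -> Prop) : (forall t, P t) -> almost_all P.
Proof. by move=> hP; exists 1 => [|t _ //]; rewrite oner_eq0. Qed.

Lemma almost_allS (P Q : K -> Prop) :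
  (forall t, P t -> Q t) -> almost_all P -> almost_all Q.
Proof. by move=> PQ [e e0 eP]; exists e => // t /eP/PQ. Qed.

Lemma almost_allI (P Q : K -> Prop) :
  almost_all P -> almost_all Q -> almost_all (fun t => P t /\ Q t).
Proof.
move=> [e e0 eP] [d d0 dQ]; exists (e * d); first by rewrite mulf_neq0.
by move=> t; rewrite hornerM mulf_eq0 negb_or => /andP[/eP ? /dQ].
Qed.

Lemma almost_all_neq0 (e : {poly K}) : e != 0 -> almost_all (fun t => e.[t] != 0).
Proof. by move=> e0; exists e. Qed.

Lemma almost_all_param_neq0 : almost_all (fun t => t != 0).
Proof.
by exists 'X; [rewrite polyX_eq0 | move=> t; rewrite hornerX].
Qed.

Lemma poly_eval0 (e : {poly K}) : e.[0] = 1 -> e != 0.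
Proof.
by move=> e1; apply/eqP => e0; move: e1; rewrite e0 horner0 => /esym/eqP; rewrite oner_eq0.
Qed.

(** The expansion z = c t^k + (higher order) of a function rational in t.  The
coefficient c may vanish: for a fixed k, leading coefficients then add. *)
Definition lead z k c : Prop :=
  exists a b : {poly K}, [/\ b.[0] = 1, a.[0] = c &
    almost_all (fun t => z t = t ^ k * (a.[t] / b.[t]))].

Lemma lead_eq z w k c :
  almost_all (fun t => z t = w t) -> lead z k c -> lead w k c.
Proof.
move=> zw [a [b [b1 ac h]]]; exists a, b; split=> //.
by apply: almost_allS (almost_allI zw h) => t [<-].
Qed.

Lemma lead_poly (a : {poly K}) : lead (horner a) 0 a.[0].
Proof.
exists a, 1; split=> //; first by rewrite hornerC.
by apply: almost_allT => t; rewrite expr0z mul1r hornerC divr1.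
Qed.

Lemma lead_cst c : lead (fun=> c) 0 c.
Proof.
have := lead_poly c%:P; rewrite hornerC; apply: lead_eq.
by apply: almost_allT => t; rewrite hornerC.
Qed.

Lemma lead_param : lead id 1 1.
Proof.
exists 1, 1; split=> //; rewrite ?hornerC //.
by apply: almost_allT => t; rewrite hornerC divr1 mulr1 expr1z.
Qed.

Lemma lead_add z w k c d :
  lead z k c -> lead w k d -> lead (fun t => z t + w t) k (c + d).
Proof.
move=> [a [b [b1 ac h]]] [a' [b' [b1' ac' h']]].
exists (a * b' + a' * b), (b * b'); split.
- by rewrite hornerM b1 b1' mulr1.
- by rewrite hornerD !hornerM b1 b1' ac ac' !mulr1.
have hb := almost_all_neq0 (poly_eval0 b1).
have hb' := almost_all_neq0 (poly_eval0 b1').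
apply: almost_allS (almost_allI (almost_allI h h') (almost_allI hb hb')).
move=> t [[-> ->] [B B']]; rewrite -mulrDr addf_div //.
by rewrite !(hornerM, hornerD).
Qed.

Lemma lead_mul z w k l c d :
  lead z k c -> lead w l d -> lead (fun t => z t * w t) (k + l) (c * d).
Proof.
move=> [a [b [b1 ac h]]] [a' [b' [b1' ac' h']]].
exists (a * a'), (b * b'); split.
- by rewrite hornerM b1 b1' mulr1.
- by rewrite !hornerM ac ac'.
apply: almost_allS (almost_allI (almost_allI h h') almost_all_param_neq0).
move=> t [[-> ->] t0]; rewrite mulrACA -expfzDr // mulf_div.
by rewrite !hornerM.
Qed.

Lemma lead_exp z k c n :
  lead z k c -> lead (fun t => z t ^+ n) (k * n%:Z) (c ^+ n).
Proof.
move=> h; elim: n => [|n IH].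
  by rewrite mulr0; exact: lead_cst.
rewrite exprS (_ : k * n.+1%:Z = k + k * n%:Z); last by lia.
by apply: lead_eq (lead_mul h IH); apply: almost_allT => t; rewrite exprS.
Qed.

Lemma lead_inv z k c : c != 0 -> lead z k c -> lead (fun t => (z t)^-1) (- k) c^-1.
Proof.
move=> c0 [a [b [b1 ac h]]]; exists (c^-1 *: b), (c^-1 *: a).
split; rewrite ?hornerZ ?b1 ?ac ?mulVf ?mulr1 //.
apply: almost_allS h => t ->.
rewrite !hornerZ invfM invf_div -invr_expz; congr (_ * _).
by rewrite -mulf_div divff ?invr_eq0 // mul1r.
Qed.

Lemma lead_lower z k l c : (l < k)%R -> lead z k c -> lead z l 0.
Proof.
move=> lk [a [b [b1 ac h]]].
have [n kE] : exists n : nat, k = l + n.+1%:Z.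
  by exists (`|k - l|%N.-1); lia.
exists ('X^(n.+1) * a), b; split=> //.
  by rewrite hornerM hornerXn expr0n mul0r.
apply: almost_allS (almost_allI h almost_all_param_neq0) => t [-> t0].
by rewrite kE expfzDr // hornerM hornerXn !mulrA.
Qed.

Lemma lead_sum (I : eqType) (r : seq I) (z : I -> K -> K) k (c : I -> K) :
  (forall i, i \in r -> lead (z i) k (c i)) ->
  lead (fun t => \sum_(i <- r) z i t) k (\sum_(i <- r) c i).
Proof.
elim: r => [|i r IH] h.
  rewrite big_nil; exists 0, 1; split; rewrite ?hornerC //.
  by apply: almost_allT => t; rewrite horner0 big_nil mul0r mulr0.
rewrite big_cons.
have hr : forall j, j \in r -> lead (z j) k (c j).
  by move=> j jr; apply: h; rewrite inE jr orbT.
apply: lead_eq (lead_add (h i (mem_head _ _)) (IH hr)).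
by apply: almost_allT => t; rewrite big_cons.
Qed.

(** At the least of the orders, all the other terms have coefficient 0. *)
Lemma lead_dominant (I : eqType) (r : seq I) (z : I -> K -> K)
    (k : I -> int) (c : I -> K) (i0 : I) :
  uniq r -> i0 \in r -> (forall i, i \in r -> lead (z i) (k i) (c i)) ->
  (forall i, i \in r -> i != i0 -> (k i0 < k i)%R) ->
  lead (fun t => \sum_(i <- r) z i t) (k i0) (c i0).
Proof.
move=> ur ir h lt.
have -> : c i0 = \sum_(i <- r) (if i == i0 then c i else 0).
  rewrite (bigD1_seq i0) //= eqxx big1 ?addr0 // => i /negPf ->.
  by [].
apply: lead_sum => i hi; case: eqP => [->|/eqP ne]; first exact: h.
exact: lead_lower (lt i hi ne) (h i hi).
Qed.

Lemma lead_neq0 z k c : c != 0 -> lead z k c -> almost_all (fun t => z t != 0).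
Proof.
move=> c0 [a [b [b1 ac h]]].
have a0 : a != 0.
  by apply: contra c0 => /eqP a0; rewrite -ac a0 horner0.
apply: almost_allS (almost_allI (almost_allI h almost_all_param_neq0)
  (almost_allI (almost_all_neq0 a0) (almost_all_neq0 (poly_eval0 b1)))).
move=> t [[-> t0] [A B]].
by rewrite mulf_neq0 ?expfz_neq0 // mulf_neq0 // invr_eq0.
Qed.

Definition has_order z k : Prop := exists2 c, c != 0 & lead z k c.

Lemma has_order_mul z w k l :
  has_order z k -> has_order w l -> has_order (fun t => z t * w t) (k + l).
Proof.
move=> [c c0 hc] [d d0 hd]; exists (c * d); first by rewrite mulf_neq0.
exact: lead_mul.
Qed.

Lemma has_order_inv z k : has_order z k -> has_order (fun t => (z t)^-1) (- k).
Proof.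
by move=> [c c0 hc]; exists c^-1; [rewrite invr_eq0 | exact: lead_inv].
Qed.

Lemma has_order_exp z k n :
  has_order z k -> has_order (fun t => z t ^+ n) (k * n%:Z).
Proof.
by move=> [c c0 hc]; exists (c ^+ n); [rewrite expf_neq0 | exact: lead_exp].
Qed.

Lemma has_order_neq0 z k : has_order z k -> almost_all (fun t => z t != 0).
Proof. by move=> [c c0 hc]; apply: lead_neq0 hc. Qed.

End Germs.

(** * Sequences of rays and orders of forms along curves *)

Section Rays.

Definition dot (d w : int * int) : int := d.1 * w.1 + d.2 * w.2.

(** Directions along which no nontrivial Laurent monomial stays neutral. *)
Definition generic_rays (w : nat -> int * int) : Prop :=
  forall d : int * int, d != 0 -> exists n0 : nat,
    (forall n, (n0 <= n)%N -> 0 < dot d (w n)) \/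
    (forall n, (n0 <= n)%N -> dot d (w n) < 0).

(** Along vectors of strictly increasing slope, a linear form changes sign at most
once and vanishes at most once. *)
Lemma generic_raysP (w : nat -> int * int) :
  (forall n, 0 < (w n).1) ->
  (forall n, 0 < (w n).1 * (w n.+1).2 - (w n.+1).1 * (w n).2) ->
  generic_rays w.
Proof.
move=> w1 det [d1 d2] d0.
(* once the form is zero or has the sign of d2, its next value has that sign *)
have cross n : (w n).1 * dot (d1, d2) (w n.+1) - (w n.+1).1 * dot (d1, d2) (w n)
    = d2 * ((w n).1 * (w n.+1).2 - (w n.+1).1 * (w n).2).
  by rewrite /dot /=; ring.
have [d2_gt|d2_lt|d20] := ltgtP d2 0.
- have [[n0 h0]|all] := pselect (exists n0, dot (d1, d2) (w n0) <= 0).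
    exists n0.+1; right => -[//|n] le_n.
    suff neg k : dot (d1, d2) (w (n0 + k).+1) < 0.
      by rewrite -(subnKC (le_n : (n0 <= n)%N)).
    elim: k => [|k IH]; rewrite ?addn0 ?addnS.
      by have := cross n0; have := det n0; have := w1 n0; have := w1 n0.+1; nia.
    have := cross (n0 + k).+1; have := det (n0 + k).+1.
    by have := w1 (n0 + k).+1; have := w1 (n0 + k).+2; nia.
  by exists 0%N; left => n _; rewrite ltNge; apply/negP => h; apply: all; exists n.
- have [[n0 h0]|all] := pselect (exists n0, 0 <= dot (d1, d2) (w n0)).
    exists n0.+1; left => -[//|n] le_n.
    suff pos k : 0 < dot (d1, d2) (w (n0 + k).+1).
      by rewrite -(subnKC (le_n : (n0 <= n)%N)).
    elim: k => [|k IH]; rewrite ?addn0 ?addnS.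
      by have := cross n0; have := det n0; have := w1 n0; have := w1 n0.+1; nia.
    have := cross (n0 + k).+1; have := det (n0 + k).+1.
    by have := w1 (n0 + k).+1; have := w1 (n0 + k).+2; nia.
  by exists 0%N; right => n _; rewrite ltNge; apply/negP => h; apply: all; exists n.
- have {}d0 : d1 != 0 by apply: contra d0 => /eqP ->; rewrite d20.
  exists 0%N; rewrite /dot /= d20.
  case: (ltgtP d1 0) d0 => // h _; [right|left] => n _; have := w1 n; nia.
Qed.

Lemma generic_rays_opp (w : nat -> int * int) :
  generic_rays w -> generic_rays (fun n => ((w n).1, - (w n).2)).
Proof.
move=> gw [d1 d2] d0; have /gw[n0 h] : ((d1, - d2) : int * int) != 0.
  by apply: contra d0 => /eqP[-> /eqP]; rewrite oppr_eq0 => /eqP ->.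
exists n0; case: h => h; [left|right] => n /h; rewrite /dot /=; lia.
Qed.

(** Finitely many differences of exponents have to be given a sign. *)
Lemma eventually_unique_min (w : nat -> int * int) (I : eqType) (r : seq I)
    (e : I -> int * int) :
  generic_rays w -> {in r &, injective e} -> r != [::] ->
  exists i0 n0, i0 \in r /\ forall n, (n0 <= n)%N ->
    forall i, i \in r -> i != i0 -> dot (e i0) (w n) < dot (e i) (w n).
Proof.
move=> gw; elim: r => // i r IH inj _.
have [->|r0] := eqVneq r [::].
  exists i, 0%N; split; first by rewrite inE.
  by move=> n _ j; rewrite inE => ->.
have {IH}[|i0 [n0 [i0r h]]] := IH _ r0.
  by move=> a b ar br; apply: inj; rewrite inE ?ar ?br orbT.
have [ii0|ne] := eqVneq i i0.
  exists i0, n0; split; first by rewrite inE i0r orbT.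
  move=> n le j; rewrite inE => /orP[/eqP ->|]; first by rewrite ii0 eqxx.
  exact: h.
have : e i - e i0 != 0.
  apply: contra ne => /eqP/subr0_eq/inj ->; rewrite ?inE ?eqxx ?i0r ?orbT //.
move=> /gw[n1 [pos|neg]].
- exists i0, (maxn n0 n1); split; first by rewrite inE i0r orbT.
  move=> n; rewrite geq_max => /andP[le0 le1] j; rewrite inE.
  case/orP=> [/eqP -> _|]; last exact: h.
  by have := pos n le1; rewrite /dot /=; lia.
- exists i, (maxn n0 n1); split; first by rewrite inE eqxx.
  move=> n; rewrite geq_max => /andP[le0 le1] j; rewrite inE.
  case/orP=> [/eqP -> /eqP//|jr _].
  have lt : dot (e i) (w n) < dot (e i0) (w n).
    by have := neg n le1; rewrite /dot /=; lia.
  by have [-> //|/(h n le0 j jr)] := eqVneq j i0; apply: lt_trans.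
Qed.

End Rays.

Section FormsOnRays.
Variable K : closedFieldType.
Implicit Types (h : {mpoly K[3]}) (x y : K -> K).

Definition ix : 'I_3 := inord 0.
Definition iy : 'I_3 := inord 1.
Definition iz : 'I_3 := inord 2.

(** Paired with the orders of x and y, this is the order of the monomial in the
chart z = 1.  The exponent of z may be forgotten on forms of a given degree. *)
Definition planar_weight (m : 'X_{1..3}) : int * int := ((m ix)%:Z, (m iy)%:Z).

Lemma big_I3 (T : Type) (idx : T) (op : Monoid.law idx) (F : 'I_3 -> T) :
  \big[op/idx]_(i < 3) F i = op (F ix) (op (F iy) (F iz)).
Proof.
rewrite !big_ord_recl big_ord0 Monoid.mulm1.
by congr (op (F _) (op (F _) (F _))); apply: val_inj; rewrite /= inordK.
Qed.

Lemma eval_affine h (a : K * K) :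
  h.@[affine_row a 0] = \sum_(m <- msupp h) h@_m * (a.1 ^+ m ix * a.2 ^+ m iy).
Proof.
rewrite mevalE; apply: eq_bigr => m _; rewrite big_I3 /= !mxE !inordK //=.
by rewrite expr1n mulr1.
Qed.

Lemma planar_weightI (m m' : 'X_{1..3}) :
  mdeg m = mdeg m' -> planar_weight m = planar_weight m' -> m = m'.
Proof.
rewrite !mdegE !big_I3 /= => e [e0 e1].
have e2 : m iz = m' iz by lia.
have ordE (i j : 'I_3) : val i = val j -> m j = m' j -> m i = m' i.
  by move=> /val_inj ->.
apply/mnmP => -[[|[|[|//]]] lt];
  [apply: (ordE _ ix) | apply: (ordE _ iy) | apply: (ordE _ iz)] => //;
  by rewrite /= inordK.
Qed.

Lemma planar_weight_inj h d :
  h \is d.-homog -> {in msupp h &, injective planar_weight}.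
Proof.
move=> /dhomogP hom m m' /hom hm /hom hm'.
by apply: planar_weightI; rewrite hm.
Qed.

(** The monomial of least order is the same along all far rays, and it dominates
whatever the leading coefficients of x and y are. *)
Lemma form_order h d (w : nat -> int * int) :
  h \is d.-homog -> h != 0 -> generic_rays w ->
  exists m n0, m \in msupp h /\ forall n, (n0 <= n)%N ->
    forall (l : int) x y, 0 < l ->
      has_order x (l * (w n).1) -> has_order y (l * (w n).2) ->
      has_order (fun t => h.@[affine_row (x t, y t) 0])
        (l * dot (planar_weight m) (w n)).
Proof.
move=> hom h0 gw.
have s0 : (msupp h : seq _) != [::] by rewrite msupp_eq0.
have [m [n0 [mh min]]] :=
  eventually_unique_min gw (planar_weight_inj hom) s0.
exists m, n0; split=> // n le_n l x y l0 [cx cx0 hx] [cy cy0 hy].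
exists (h@_m * (cx ^+ m ix * cy ^+ m iy)).
  by rewrite !mulf_neq0 ?expf_neq0 // -mcoeff_msupp.
pose z (m : 'X_{1..3}) t := h@_m * (x t ^+ m ix * y t ^+ m iy).
pose k m := l * dot (planar_weight m) (w n).
pose c (m : 'X_{1..3}) := h@_m * (cx ^+ m ix * cy ^+ m iy).
have lz m' : lead (z m') (k m') (c m').
  have := lead_mul (lead_cst h@_m') (lead_mul (lead_exp (m' ix) hx) (lead_exp (m' iy) hy)).
  by rewrite add0r; congr (lead _ _ _); rewrite /k /dot /=; lia.
apply: (@lead_eq _ (fun t => \sum_(m' <- msupp h) z m' t)).
  by apply: almost_allT => t; rewrite eval_affine.
apply: (@lead_dominant _ _ (msupp h) z k c m) => // m' m'h ne.
by rewrite /k ltr_pM2l //; exact: min.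
Qed.

(** Subtracting from A the multiple of B that removes the dominating monomial of B
forces the dominating monomials of A - c B and B to differ; the order of A / B - c
is then the pairing of a nonzero exponent with the ray. *)
Lemma ratio_order (A B : {mpoly K[3]}) d (w : nat -> int * int) :
  A \is d.-homog -> B \is d.-homog -> B != 0 -> (forall c, A != c *: B) ->
  generic_rays w ->
  exists (c : K) (alpha beta : nat -> int) (n0 : nat), forall n, (n0 <= n)%N ->
    alpha n != beta n /\
    forall (l : int) x y, 0 < l ->
      has_order x (l * (w n).1) -> has_order y (l * (w n).2) ->
      has_order (fun t => (A - c *: B).@[affine_row (x t, y t) 0]) (l * alpha n) /\
      has_order (fun t => B.@[affine_row (x t, y t) 0]) (l * beta n).
Proof.
move=> homA homB B0 AB gw.
have [mB [nB [mBB hB]]] := form_order homB B0 gw.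
pose c := A@_mB / B@_mB.
have homC : A - c *: B \is d.-homog by apply: dhomogD => //; rewrite dhomogN dhomogZ.
have C0 : A - c *: B != 0 by rewrite subr_eq0.
have [mC [nC [mCC hC]]] := form_order homC C0 gw.
have ne : planar_weight mC != planar_weight mB.
  have := mBB; rewrite mcoeff_msupp => mBB'.
  have CB0 : (A - c *: B)@_mB = 0.
    by rewrite mcoeffB mcoeffZ divfK // subrr.
  apply: contraTneq (mCC) => /= e; rewrite mcoeff_msupp negbK.
  by rewrite (planar_weightI _ e) ?CB0 // (dhomog_mf homC mCC) (dhomog_mf homB mBB).
have /gw[n1 h1] : planar_weight mC - planar_weight mB != 0 by rewrite subr_eq0.
exists c, (fun n => dot (planar_weight mC) (w n)),
  (fun n => dot (planar_weight mB) (w n)), (maxn (maxn nB nC) n1) => n.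
rewrite !geq_max => /andP[/andP[leB leC] le1]; split.
  by case: h1 => /(_ n le1); rewrite /dot /=; lia.
by move=> l x y l0 hx hy; split; [exact: hC | exact: hB].
Qed.

End FormsOnRays.

(** * Orders along the orbits of the mutation *)

Section MutationOrders.
Variables (K : closedFieldType) (P Q : nat).
Implicit Types (x y : K -> K) (X Y Z : K -> K * K) (a b l u v : int).

Let m1 := @mu1 K (- Q%:Z).
Let m2 := @mu2 K (- P%:Z).
Let f z := m2 (m1 z).

(** The formulas defining the first n steps involve no division by zero. *)
Definition regular n (z : K * K) : Prop :=
  forall k, (k < n)%N -> in_torus (iter k f z) /\ in_torus (m1 (iter k f z)).

Definition iterates_to n X Y : Prop :=
  almost_all (fun t => regular n (X t) /\ iter n f (X t) = Y t).

Lemma iterates_to_trans n m X Y Z :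
  iterates_to n X Y -> iterates_to m Y Z -> iterates_to (n + m) X Z.
Proof.
move=> h h'; apply: almost_allS (almost_allI h h') => t [[r e] [r' e']].
split; last by rewrite addnC iterD e.
move=> k lt; have [/r//|le] := ltnP k n.
by rewrite -(subnK le) iterD e; apply: r'; lia.
Qed.

Lemma iterates_to_refl X : iterates_to 0 X X.
Proof. by apply: almost_allT => t; split. Qed.

Hypotheses (P_gt0 : (0 < P)%N) (Q_gt0 : (0 < Q)%N).

(** Of the two terms of 1 + x^(-e) the one of smaller order dominates; a nonzero
order of x excludes a tie. *)
Lemma has_order_1DVX_neg x a e : (0 < e)%N -> a < 0 ->
  has_order x a -> has_order (fun t => 1 + x t ^ (- e%:Z)) 0.
Proof.
move=> e0 a0 hx; have [c c0 hc] := has_order_inv (has_order_exp e hx).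
exists (1 + 0); first by rewrite addr0 oner_eq0.
apply: lead_eq (lead_add (lead_cst 1) (lead_lower _ hc)); last by nia.
by apply: almost_allT => t; rewrite -exprnN.
Qed.

Lemma has_order_1DVX_pos x a e : (0 < e)%N -> 0 < a ->
  has_order x a -> has_order (fun t => 1 + x t ^ (- e%:Z)) (- (a * e%:Z)).
Proof.
move=> e0 a0 hx; have [c c0 hc] := has_order_inv (has_order_exp e hx).
exists (0 + c); first by rewrite add0r.
apply: lead_eq (lead_add (lead_lower _ (lead_cst 1)) hc); last by nia.
by apply: almost_allT => t; rewrite -exprnN.
Qed.

Definition has_orders X (w : int * int) : Prop :=
  has_order (fun t => (X t).1) w.1 /\ has_order (fun t => (X t).2) w.2.

Lemma has_orders_torus X w :
  has_orders X w -> almost_all (fun t => in_torus (X t)).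
Proof. by move=> [/has_order_neq0 h1 /has_order_neq0 h2]; apply: almost_allI. Qed.

Lemma mu1_orders_neg X a b : b < 0 ->
  has_orders X (a, b) -> has_orders (fun t => m1 (X t)) (- a, b).
Proof.
move=> b0 [/= h1 h2]; split=> //=; rewrite -[- a]add0r.
exact: has_order_mul (has_order_1DVX_neg Q_gt0 b0 h2) (has_order_inv h1).
Qed.

Lemma mu1_orders_pos X a b : 0 < b ->
  has_orders X (a, b) -> has_orders (fun t => m1 (X t)) (- (b * Q%:Z) - a, b).
Proof.
move=> b0 [/= h1 h2]; split=> //=.
exact: has_order_mul (has_order_1DVX_pos Q_gt0 b0 h2) (has_order_inv h1).
Qed.

Lemma mu2_orders_neg X a b : a < 0 ->
  has_orders X (a, b) -> has_orders (fun t => m2 (X t)) (a, - b).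
Proof.
move=> b0 [/= h1 h2]; split=> //=; rewrite -[- b]add0r.
exact: has_order_mul (has_order_1DVX_neg P_gt0 b0 h1) (has_order_inv h2).
Qed.

Lemma mu2_orders_pos X a b : 0 < a ->
  has_orders X (a, b) -> has_orders (fun t => m2 (X t)) (a, - (a * P%:Z) - b).
Proof.
move=> b0 [/= h1 h2]; split=> //=.
exact: has_order_mul (has_order_1DVX_pos P_gt0 b0 h1) (has_order_inv h2).
Qed.

Lemma forward_step X w w' :
  has_orders X w -> has_orders (fun t => m1 (X t)) w' ->
  iterates_to 1 X (fun t => f (X t)).
Proof.
move=> /has_orders_torus h /has_orders_torus h'.
by apply: almost_allS (almost_allI h h') => t [? ?]; split=> // -[].
Qed.

Lemma mu1K z : in_torus z -> in_torus (m1 z) -> m1 (m1 z) = z.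
Proof.
case: z => a b [/= a0 b0] [/=]; rewrite /m1 /mu1 /= mulf_eq0 negb_or.
by move=> /andP[s0 _] _; rewrite invf_div mulrCA divff // mulr1.
Qed.

Lemma mu2K z : in_torus z -> in_torus (m2 z) -> m2 (m2 z) = z.
Proof.
case: z => a b [/= a0 b0] [/=]; rewrite /m2 /mu2 /= mulf_eq0 negb_or.
by move=> _ /andP[s0 _]; rewrite invf_div mulrCA divff // mulr1.
Qed.

(** As mu1 and mu2 are involutions, mu1 o mu2 undoes a step. *)
Lemma backward_step X w w' w'' :
  has_orders X w -> has_orders (fun t => m2 (X t)) w' ->
  has_orders (fun t => m1 (m2 (X t))) w'' ->
  iterates_to 1 (fun t => m1 (m2 (X t))) X.
Proof.
move=> /has_orders_torus h /has_orders_torus h' /has_orders_torus h''.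
apply: almost_allS (almost_allI h (almost_allI h' h'')) => t [T [T' T'']].
have e : m1 (m1 (m2 (X t))) = m2 (X t) by apply: mu1K.
split; last by rewrite /= /f e; apply: mu2K.
by case=> // _; rewrite /= e.
Qed.

(** Up to the factor l, the orders met along the orbit are u, -v, then -u, v,
u - Q v, -v, Q v - u and v - P (Q v - u): on the quadrant of signs (+, -), the
third iterate is linear on orders. *)
Lemma forward_cycle X l u v : 0 < l -> 0 < u -> 0 < v -> u < Q%:Z * v ->
  has_orders X (l * u, - (l * v)) ->
  exists2 Y, iterates_to 3 X Y &
    has_orders Y (l * (Q%:Z * v - u), - (l * (P%:Z * (Q%:Z * v - u) - v))).
Proof.
move=> l0 u0 v0 uv hX.
pose X1 t := f (X t); pose X2 t := f (X1 t).
have h0 := mu1_orders_neg _ hX; have {h0}h0 := h0 ltac:(nia).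
have h1 := mu2_orders_neg _ h0; have {h1}h1 := h1 ltac:(nia).
have h2 := mu1_orders_pos _ h1; have {h2}h2 := h2 ltac:(nia).
have h3 := mu2_orders_neg _ h2; have {h3}h3 := h3 ltac:(nia).
have h4 := mu1_orders_neg _ h3; have {h4}h4 := h4 ltac:(nia).
have h5 := mu2_orders_pos _ h4; have {h5}h5 := h5 ltac:(nia).
exists (fun t => f (X2 t)).
  apply: (iterates_to_trans (forward_step hX h0) (n := 1) (m := 2)).
  apply: (iterates_to_trans (forward_step h1 h2) (n := 1) (m := 1)).
  exact: forward_step h3 h4.
case: h5 => h5 h5'; split; [move: h5 | move: h5'] => /=; congr has_order; lia.
Qed.

(** With a = P u - v, the inverse steps produce, up to the factor l, the orders -a,
-u, a, u - Q a, -a and Q a - u. *)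
Lemma backward_cycle X l u v :
    0 < l -> 0 < u -> v < P%:Z * u -> u < Q%:Z * (P%:Z * u - v) ->
  has_orders X (l * u, - (l * v)) ->
  exists2 Y, iterates_to 3 Y X &
    has_orders Y (l * (Q%:Z * (P%:Z * u - v) - u), - (l * (P%:Z * u - v))).
Proof.
move=> l0 u0 vu uv hX.
have h0 := mu2_orders_pos _ hX; have {h0}h0 := h0 ltac:(nia).
have h1 := mu1_orders_neg _ h0; have {h1}h1 := h1 ltac:(nia).
have h2 := mu2_orders_neg _ h1; have {h2}h2 := h2 ltac:(nia).
have h3 := mu1_orders_pos _ h2; have {h3}h3 := h3 ltac:(nia).
have h4 := mu2_orders_neg _ h3; have {h4}h4 := h4 ltac:(nia).
have h5 := mu1_orders_neg _ h4; have {h5}h5 := h5 ltac:(nia).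
exists (fun t => m1 (m2 (m1 (m2 (m1 (m2 (X t))))))).
  apply: (iterates_to_trans (backward_step h3 h4 h5) (n := 1) (m := 2)).
  apply: (iterates_to_trans (backward_step h1 h2 h3) (n := 1) (m := 1)).
  exact: backward_step hX h0 h1.
case: h5 => h5 h5'; split; [move: h5 | move: h5'] => /=; congr has_order; lia.
Qed.

(** The orders of the iterates of index 3 j + 1 of the curve below are (u, -v), up to
scale, for (u, v) = forward_dir j; those of index - 3 j have (u, v) =
backward_dir j. *)
Definition forward_dir (j : nat) : int * int :=
  iter j (fun d => (Q%:Z * d.2 - d.1, P%:Z * (Q%:Z * d.2 - d.1) - d.2)) (1, P%:Z).

Definition backward_dir (j : nat) : int * int :=
  iter j (fun d => (Q%:Z * (P%:Z * d.1 - d.2) - d.1, P%:Z * d.1 - d.2)) (1, 0).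

Lemma forward_dirS j : forward_dir j.+1 =
  (Q%:Z * (forward_dir j).2 - (forward_dir j).1,
   P%:Z * (Q%:Z * (forward_dir j).2 - (forward_dir j).1) - (forward_dir j).2).
Proof. by []. Qed.

Lemma backward_dirS j : backward_dir j.+1 =
  (Q%:Z * (P%:Z * (backward_dir j).1 - (backward_dir j).2) - (backward_dir j).1,
   P%:Z * (backward_dir j).1 - (backward_dir j).2).
Proof. by []. Qed.

Hypothesis PQ_ge4 : (4 <= P * Q)%N.

(** The bound reproduces itself because P Q >= 4: from 2 u <= Q v one gets
2 v <= P (Q v - u), and the same step with P and Q exchanged gives the bound for
the next vector. *)
Lemma forward_dir_cone j : [/\ 0 < (forward_dir j).1, 0 < (forward_dir j).2 &
  2 * (forward_dir j).1 <= Q%:Z * (forward_dir j).2].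
Proof.
elim: j => [|j]; first by split=> /=; lia.
rewrite forward_dirS.
case: (forward_dir j) => u v /= [u0 v0 uv]; have u'0 : 0 < Q%:Z * v - u by lia.
have uv' : 2 * v <= P%:Z * (Q%:Z * v - u) by nia.
by split=> //; nia.
Qed.

(** The recursion is linear of determinant 1, so that consecutive vectors span a
constant area; this makes the slopes monotone. *)
Lemma forward_dir_det j : (forward_dir j).1 * (forward_dir j.+1).2 -
  (forward_dir j.+1).1 * (forward_dir j).2 = - P%:Z.
Proof.
elim: j => [|j IH]; first by rewrite /=; lia.
rewrite -[RHS]IH (forward_dirS j.+1) (forward_dirS j).
by case: (forward_dir j) => u v /=; ring.
Qed.

Lemma backward_dir_cone j : [/\ 0 < (backward_dir j).1, 0 <= (backward_dir j).2 &
  2 * (backward_dir j).2 <= P%:Z * (backward_dir j).1].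
Proof.
elim: j => [|j]; first by split=> /=; lia.
rewrite backward_dirS.
case: (backward_dir j) => u v /= [u0 v0 uv]; have a0 : 0 < P%:Z * u - v by nia.
have ua : 2 * u <= Q%:Z * (P%:Z * u - v) by nia.
by split; nia.
Qed.

Lemma backward_dir_det j : (backward_dir j).1 * (backward_dir j.+1).2 -
  (backward_dir j.+1).1 * (backward_dir j).2 = P%:Z.
Proof.
elim: j => [|j IH]; first by rewrite /=; lia.
rewrite -[RHS]IH (backward_dirS j.+1) (backward_dirS j).
by case: (backward_dir j) => u v /=; ring.
Qed.

Lemma forward_dir_generic :
  generic_rays (fun j => ((forward_dir j).1, - (forward_dir j).2)).
Proof.
apply: generic_raysP => j; first by case: (forward_dir_cone j).
by move: (forward_dir_det j); case: (forward_dir j) (forward_dir j.+1) => [u v] [u' v'] /=; lia.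
Qed.

Lemma backward_dir_generic :
  generic_rays (fun j => ((backward_dir j).1, - (backward_dir j).2)).
Proof.
apply: generic_rays_opp; apply: generic_raysP => j.
  by case: (backward_dir_cone j).
by have := backward_dir_det j; lia.
Qed.

Lemma forward_orbit X l j : 0 < l -> has_orders X (l, - (l * P%:Z)) ->
  exists2 Y, iterates_to (3 * j) X Y &
    has_orders Y (l * (forward_dir j).1, - (l * (forward_dir j).2)).
Proof.
move=> l0 hX; elim: j => [|j [Y XY hY]].
  by exists X; [exact: iterates_to_refl | rewrite /= mulr1].
have [u0 v0 uv] := forward_dir_cone j.
have [|Z YZ hZ] := forward_cycle l0 u0 v0 _ hY; first by lia.
by exists Z => //; rewrite mulnSr; apply: iterates_to_trans YZ.
Qed.

Lemma backward_orbit X l j : 0 < l -> has_orders X (l, 0) ->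
  exists2 Y, iterates_to (3 * j) Y X &
    has_orders Y (l * (backward_dir j).1, - (l * (backward_dir j).2)).
Proof.
move=> l0 hX; elim: j => [|j [Y XY hY]].
  by exists X; [exact: iterates_to_refl | rewrite /= mulr1 mulr0 oppr0].
have [u0 v0 uv] := backward_dir_cone j.
have a0 : (backward_dir j).2 < P%:Z * (backward_dir j).1 by nia.
have [|Z YZ hZ] := backward_cycle l0 u0 a0 _ hY.
  by case: (backward_dir_cone j.+1) => /=; lia.
by exists Z => //; rewrite mulnS; apply: iterates_to_trans YZ XY.
Qed.

Variable w : K.
Hypotheses (char0 : forall n, n.+1%:R != 0 :> K) (wQ : w ^+ Q = - 1).

(** It has contact of order n + 2 with the line y = w, on which 1 + y^(-Q)
vanishes. *)
Definition critical_curve (n : nat) (t : K) : K * K := (t, w + t ^+ n.+2).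

Lemma critical_base_neq0 : w != 0.
Proof.
apply: contra_eq_neq wQ => ->; rewrite expr0n gtn_eqF //.
by rewrite eq_sym oppr_eq0 oner_eq0.
Qed.

Lemma lead_critical_snd n : lead (fun t : K => w + t ^+ n.+2) 0 w.
Proof.
suff : lead (fun t : K => w + t ^+ n.+2) 0 (w + 0) by rewrite addr0.
by apply: lead_add (lead_cst w) (lead_lower _ (lead_exp n.+2 (lead_param K))).
Qed.

Lemma critical_orders n : has_orders (critical_curve n) (1, 0).
Proof.
split; first by exists 1; [exact: oner_neq0 | exact: lead_param].
by exists w; [exact: critical_base_neq0 | exact: lead_critical_snd].
Qed.

(** The zero of Y^Q + 1 at w is simple in characteristic 0, so that 1 + y^(-Q) has
the contact order n + 2; the division by x = t removes one. *)
Lemma mu1_critical_orders n :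
  has_orders (fun t => m1 (critical_curve n t)) (n.+1%:Z, 0).
Proof.
have w0 := critical_base_neq0.
have h2 := lead_critical_snd n.
split; last by exists w.
(* the cofactor of t^(n+2) in (w + t^(n+2))^Q - w^Q takes the value Q w^(Q-1) at 0 *)
have hs : has_order (fun t : K => \sum_(i <- index_enum 'I_Q)
    (w + t ^+ n.+2) ^+ (Q.-1 - i) * w ^+ i) 0.
  exists (\sum_(i <- index_enum 'I_Q) w ^+ (Q.-1 - i) * w ^+ i).
    have -> : \sum_(i <- index_enum 'I_Q) w ^+ (Q.-1 - i) * w ^+ i = w ^+ Q.-1 *+ Q.
      transitivity (\sum_(i < Q) w ^+ Q.-1); last by rewrite sumr_const card_ord.
      apply: eq_bigr => i _.
      by rewrite -exprD; congr (w ^+ _); have := ltn_ord i; lia.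
    by rewrite -mulr_natr mulf_neq0 ?expf_neq0 // -(prednK Q_gt0).
  apply: lead_sum => i _; rewrite -(addr0 (0 : int)).
  apply: lead_mul (lead_cst _).
  by have := lead_exp (Q.-1 - i) h2; rewrite mul0r.
have hx : has_order (id : K -> K) 1 by exists 1; [exact: oner_neq0 | exact: lead_param].
have hy : has_order (fun t : K => w + t ^+ n.+2) 0 by exists w.
have := has_order_mul (has_order_mul (has_order_mul (has_order_exp n.+2 hx) hs)
  (has_order_inv (has_order_exp Q hy))) (has_order_inv hx).
rewrite mul0r oppr0 !addr0 mul1r /= (_ : n.+2%:Z - 1 = n.+1%:Z); last by lia.
move=> [c c0 hc]; exists c => //; apply: lead_eq hc.
have [d d0 /(lead_neq0 d0)] := hy; apply: almost_allS => t y0.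
rewrite /m1 /mu1 /critical_curve /= -exprnN; congr (_ / _).
have /esym := subrXX (w + t ^+ n.+2) w Q; rewrite wQ opprK [w + _]addrC addrK => ->.
by rewrite mulrDl divff ?expf_neq0 1?addrC // mul1r.
Qed.

(** The contact order rescales the future of the curve but not its past; this is
what makes the two ends of the orbit independent. *)
Lemma critical_forward n j :
  exists2 Y, iterates_to (3 * j).+1 (critical_curve n) Y &
    has_orders Y (n.+1%:Z * (forward_dir j).1, n.+1%:Z * - (forward_dir j).2).
Proof.
have h0 := critical_orders n; have h1 := mu1_critical_orders n.
have := mu2_orders_pos (ltac:(lia) : 0 < n.+1%:Z) h1; rewrite subr0 => h2.
have [Y XY hY] := forward_orbit j (ltac:(lia) : 0 < n.+1%:Z) h2.
exists Y; last by rewrite mulrN.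
exact: iterates_to_trans (forward_step h0 h1) XY.
Qed.

Lemma critical_backward n j :
  exists2 Y, iterates_to (3 * j) Y (critical_curve n) &
    has_orders Y ((backward_dir j).1, - (backward_dir j).2).
Proof.
have [Y YX hY] := backward_orbit j ltr01 (critical_orders n).
by exists Y => //; move: hY; rewrite !mul1r.
Qed.

End MutationOrders.

(** * Polynomial functions *)

Lemma base_expansion_inj (B n : nat) (a b : 'I_n -> nat) :
  (forall i, a i < B)%N -> (forall i, b i < B)%N ->
  (\sum_i a i * B ^ i)%N = (\sum_i b i * B ^ i)%N -> a =1 b.
Proof.
elim: n a b => [a b _ _ _ [] //|n IH a b aB bB].
have shift c : (\sum_(i < n.+1) c i * B ^ i)%N =
    ((\sum_(i < n) c (lift ord0 i) * B ^ i) * B + c ord0)%N.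
  rewrite big_ord_recl expn0 muln1 addnC big_distrl /=; congr (_ + _)%N.
  by apply: eq_bigr => i _; rewrite /bump add1n expnSr mulnA.
rewrite !shift => e.
have B0 : (0 < B)%N by apply: leq_ltn_trans (aB ord0).
have e0 : a ord0 = b ord0.
  by have /(congr1 (modn^~ B)) := e; rewrite !modnMDl !modn_small.
have /(congr1 (divn^~ B)) := e; rewrite !divnMDl // !divn_small // !addn0.
move=> /IH h i; case: (unliftP ord0 i) => [j ->|-> //].
by apply: h => j'.
Qed.

Section PolynomialFunctions.
Variable K : closedFieldType.

(** The Kronecker substitution of t^(B^i) for X_i keeps monomials with exponents
below B apart, and reduces the claim to one variable. *)
Lemma meval_neq0 n (p : {mpoly K[n]}) :
  p != 0 -> exists v : 'rV[K]_n, p.@[v 0] != 0.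
Proof.
move=> p0; pose B := msize p.
pose kron (m : 'X_{1..n}) := (\sum_i m i * B ^ i)%N.
pose q : {poly K} := \sum_(m <- msupp p) p@_m *: 'X^(kron m).
have kron_inj : {in msupp p &, injective kron}.
  have lt m : m \in msupp p -> forall i, (m i < B)%N.
    move=> /msize_mdeg_lt mB i; apply: leq_ltn_trans mB.
    by rewrite mdegE (bigD1 i) //= leq_addr.
  by move=> m m' /lt h /lt h' /(base_expansion_inj h h')/mnmP.
have /closed_nonrootP[t qt] : q != 0.
  have [m mp] : exists m, m \in msupp p.
    by move: p0; rewrite -msupp_eq0; case: (msupp p : seq _) => // m s _; exists m; rewrite inE eqxx.
  apply: contraTneq (mp) => /(congr1 (fun q : {poly K} => q`_(kron m))).
  rewrite coef_sum coef0 (bigD1_seq m) //= big1_seq.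
    by rewrite addr0 coefZ coefXn eqxx mulr1 mcoeff_msupp => ->; rewrite eqxx.
  move=> m' /andP[ne m'p]; rewrite coefZ coefXn; case: eqP => [e|_]; last by rewrite mulr0.
  by rewrite (kron_inj _ _ mp m'p e) eqxx in ne.
exists (\row_i t ^+ (B ^ i)); suff -> : p.@[(\row_i t ^+ (B ^ i)) 0] = q.[t] by [].
rewrite mevalE horner_sum; apply: eq_bigr => m _; rewrite hornerZ hornerXn.
congr (_ * _); rewrite -prodrXr; apply: eq_bigr => i _.
by rewrite mxE -exprM mulnC.
Qed.

Lemma meval_mul_eq0 n (p q : {mpoly K[n]}) :
  (forall v : 'rV[K]_n, p.@[v 0] * q.@[v 0] = 0) ->
  (forall v : 'rV[K]_n, p.@[v 0] = 0) \/ (forall v : 'rV[K]_n, q.@[v 0] = 0).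
Proof.
move=> pq; have /eqP : p * q = 0.
  apply/eqP/negPn/negP => /meval_neq0[v]; by rewrite mevalM pq eqxx.
by rewrite mulf_eq0 => /orP[]/eqP ->; [left|right] => v; rewrite meval0.
Qed.

Lemma mpolyX_neq0 n (i : 'I_n) : ('X_i : {mpoly K[n]}) != 0.
Proof.
apply/eqP => /(congr1 (meval (fun=> 1))); rewrite mevalXU meval0.
by apply/eqP; rewrite oner_eq0.
Qed.

Lemma mpolyX_homog n (i : 'I_n) : ('X_i : {mpoly K[n]}) \is 1.-homog.
Proof. by rewrite dhomogX /= mdeg1. Qed.

(** A bihomogeneous form of bidegree (d, d), that is, a polynomial relation between
a0 / a1 and b0 / b1 in which the denominators may vanish. *)
Definition biform d (p : 'M[K]_d.+1) (a0 a1 b0 b1 : K) : K :=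
  \sum_k \sum_l p k l * ((a0 ^+ k * a1 ^+ (d - k)) * (b0 ^+ l * b1 ^+ (d - l))).

Lemma size_monomial_le (u v : {poly K}) (D d k : nat) :
  (size u <= D.+1)%N -> (size v <= D.+1)%N -> (k <= d)%N ->
  (size (u ^+ k * v ^+ (d - k))%R <= (D * d).+1)%N.
Proof.
move=> su sv kd; apply: leq_trans (size_polyMleq _ _) _.
have pow (w : {poly K}) i : (size w <= D.+1 -> size (w ^+ i)%R <= (D * i).+1)%N.
  move=> sw; apply: leq_trans (size_poly_exp_leq w i) _.
  by rewrite ltnS leq_mul2r; apply/orP; right; lia.
have := leq_add (pow u k su) (pow v (d - k)%N sv).
by rewrite -[in (D * d)%N](subnKC kd) mulnDr; lia.
Qed.

(** The (d + 1)^2 coefficients of p outnumber those of the resulting polynomial,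
whose degree is linear in d. *)
Lemma univariate_biform_relation (a0 a1 b0 b1 : {poly K}) :
  exists d (p : 'M[K]_d.+1), p != 0 /\
    forall t, biform p a0.[t] a1.[t] b0.[t] b1.[t] = 0.
Proof.
have [D [sa0 sa1 sb0 sb1]] : exists D, [/\ (size a0 <= D.+1)%N,
    (size a1 <= D.+1)%N, (size b0 <= D.+1)%N & (size b1 <= D.+1)%N].
  by exists (size a0 + size a1 + size b0 + size b1)%N; split; lia.
(* the resulting degree is at most 2 D d, and (d + 1)^2 > 2 D d + 1 for this d *)
have [d dE] : {d | d = (2 * D).+1} by exists (2 * D).+1.
pose n := (2 * (D * d)).+1.
pose T k l := (a0 ^+ k * a1 ^+ (d - k)) * (b0 ^+ l * b1 ^+ (d - l)).
have sT (k l : 'I_d.+1) : (size (T k l) <= n)%N.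
  have ka := size_monomial_le sa0 sa1 (ltn_ord k : (k <= d)%N).
  have kb := size_monomial_le sb0 sb1 (ltn_ord l : (l <= d)%N).
  apply: leq_trans (size_polyMleq _ _) _; rewrite /n.
  by have := leq_add ka kb; lia.
pose idx := fun kl : 'I_d.+1 * 'I_d.+1 => mxvec_index kl.1 kl.2.
pose A := \matrix_(i < (d.+1 * d.+1)%N, j < n)
  (\sum_(kl | idx kl == i) T kl.1 kl.2)`_j.
have : kermx A != 0.
  rewrite -mxrank_eq0 mxrank_ker subn_eq0 -ltnNge.
  have many : (n < d.+1 * d.+1)%N by rewrite /n dE !(mulSn, mulnS); lia.
  exact: leq_ltn_trans (rank_leq_col A) many.
move=> /rowV0Pn[v /sub_kermxP vA v0].
exists d, (vec_mx v); split.
  by apply: contraNneq v0 => e; rewrite -[v]vec_mxK e linear0.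
have idx_inj : injective idx.
  case: (curry_mxvec_bij d.+1 d.+1) => g idxK _ [k l] [k' l'] e.
  by rewrite -[LHS]idxK // -[RHS]idxK //; congr g.
have rel : \sum_k \sum_l vec_mx v k l *: T k l = 0.
  apply/polyP => j; rewrite coef0.
  have [jn|nj] := ltnP j n; last first.
    rewrite coef_sum big1 // => k _; rewrite coef_sum big1 // => l _.
    by rewrite coefZ nth_default ?mulr0 // (leq_trans (sT k l)).
  have /rowP/(_ (Ordinal jn)) := vA; rewrite !mxE => vAj; apply: etrans vAj.
  rewrite pair_big /= coef_sum.
  rewrite (reindex _ (curry_mxvec_bij _ _)) /=.
  apply: eq_bigr => -[k l] _; rewrite coefZ !mxE; congr (_ * _).
  by rewrite (bigD1 (k, l)) //= big1 ?addr0 // => i /andP[/eqP e]; rewrite (idx_inj i (k, l) e) eqxx.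
move=> t; have /(congr1 (horner^~ t)) := rel; rewrite horner0 => <-.
rewrite horner_sum; apply: eq_bigr => k _; rewrite horner_sum.
by apply: eq_bigr => l _; rewrite hornerZ !hornerM !horner_exp.
Qed.

Lemma biform_scale d (p : 'M[K]_d.+1) (a0 a1 b0 b1 c : K) :
  biform p a0 a1 (c * b0) (c * b1) = c ^+ d * biform p a0 a1 b0 b1.
Proof.
rewrite /biform mulr_sumr; apply: eq_bigr => k _; rewrite mulr_sumr.
apply: eq_bigr => l _; rewrite -[in c ^+ d](subnKC (ltn_ord l : (l <= d)%N)).
by rewrite !exprMn exprD; ring.
Qed.

End PolynomialFunctions.

(** * Projective varieties *)

Section ProjectiveVarieties.
Variable K : closedFieldType.
Local Open Scope classical_set_scope.

Lemma meval_dhomog_scale n d (h : {mpoly K[n]}) (c : K) (u : 'rV[K]_n) :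
  h \is d.-homog -> h.@[(c *: u) 0] = c ^+ d * h.@[u 0].
Proof.
move=> /dhomog_mf hom; rewrite !mevalE mulr_sumr.
apply: eq_big_seq => m /hom md; rewrite mulrCA; congr (_ * _).
rewrite -md /= mdegE -prodrXr -big_split /=; apply: eq_bigr => i _.
by rewrite mxE exprMn.
Qed.

Lemma vanishes_at_proj_point n d (h : {mpoly K[n.+1]}) (u : 'rV[K]_n.+1)
    (u0 : u != 0) :
  h \is d.-homog -> vanishes_at h (proj_point u0) <-> h.@[u 0] = 0.
Proof.
move=> hom; split; first by apply; exact: memv_line.
by move=> hu v /vlineP[c ->]; rewrite (meval_dhomog_scale c u hom) hu mulr0.
Qed.

Lemma projspace_point n (L : projspace K n) :
  exists (u : 'rV[K]_n.+1) (u0 : u != 0), L = proj_point u0.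
Proof.
case: L => L L1; have Ln0 : L != 0%VS.
  by apply: contraTneq L1 => ->; rewrite dimv0.
have u0 : vpick L != 0 by rewrite vpick0.
exists (vpick L), u0; apply: val_inj => /=; apply/eqP.
by rewrite eq_sym eqEdim dim_vline u0 (eqP L1) leqnn andbT -memvE memv_pick.
Qed.

Lemma proj_point_eqP n (u v : 'rV[K]_n.+1) (u0 : u != 0) (v0 : v != 0) :
  proj_point u0 = proj_point v0 -> exists2 c, c != 0 & u = c *: v.
Proof.
move=> /(congr1 sval) /= uv; have : u \in <[v]>%VS by rewrite -uv memv_line.
move=> /vlineP[c uE]; exists c => //; apply: contraNneq u0 => c0.
by rewrite uE c0 scale0r.
Qed.

(** When E consists of nonzero vectors, this is the Zariski closure of the points
that they represent. *)
Definition vanishing_closure n (E : set 'rV[K]_n.+1) : set (projspace K n) :=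
  [set L | forall h d, h \is d.-homog -> (forall u, E u -> h.@[u 0] = 0) ->
     vanishes_at h L].

Lemma vanishing_closure_closed n (E : set 'rV[K]_n.+1) :
  zariski_closed (vanishing_closure E).
Proof.
exists [set h | (exists d, h \is d.-homog) /\ forall u, E u -> h.@[u 0] = 0].
  by move=> h [].
by apply/seteqP; split=> [L hL h [[d hd] hE]|L hL h d hd hE];
  [exact: hL hd hE | apply: hL; split=> //; exists d].
Qed.

Lemma sub_vanishing_closure n (E : set 'rV[K]_n.+1) u (u0 : u != 0) :
  E u -> vanishing_closure E (proj_point u0).
Proof. by move=> Eu h d hd hE; apply/(vanishes_at_proj_point u0 hd)/hE. Qed.

Lemma vanishing_closureS n (E F : set 'rV[K]_n.+1) :
  E `<=` F -> vanishing_closure E `<=` vanishing_closure F.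
Proof. by move=> EF L hL h d hd hF; apply: hL hd _ => u /EF/hF. Qed.

(** Two closed sets, neither of which contains E, yield two forms that do not vanish
on E; their product does not vanish on E either, so the union does not contain E. *)
Lemma vanishing_closure_irreducible n (E : set 'rV[K]_n.+1) :
  (exists2 u, E u & u != 0) -> (forall u, E u -> u != 0) ->
  (forall h1 h2 : {mpoly K[n.+1]}, (forall u, E u -> h1.@[u 0] * h2.@[u 0] = 0) ->
     (forall u, E u -> h1.@[u 0] = 0) \/ (forall u, E u -> h2.@[u 0] = 0)) ->
  irreducible_closed (vanishing_closure E).
Proof.
move=> [u Eu u0] E0 prime; split; first exact: vanishing_closure_closed.
  by exists (proj_point u0); apply: sub_vanishing_closure.
move=> A B [SA hA ->] [SB hB ->] sub; apply: contrapT => /not_orP[nA nB].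
have ex S : (forall h, S h -> exists d, h \is d.-homog) ->
    ~ (vanishing_closure E `<=` [set L | forall h, S h -> vanishes_at h L]) ->
    exists2 h, S h & ~ forall u, E u -> h.@[u 0] = 0.
  move=> hS; apply: contra_notP => none L hL h Sh; have [d hd] := hS h Sh.
  apply: hL hd _; apply: contrapT => nE; apply: none; by exists h.
have [hA' SA' nA'] := ex _ hA nA; have [hB' SB' nB'] := ex _ hB nB.
case: (prime hA' hB') => // v Ev.
have := sub _ (@sub_vanishing_closure _ _ _ (E0 v Ev) Ev).
by case=> [/(_ _ SA' v (memv_line v)) | /(_ _ SB' v (memv_line v))] ->; rewrite ?mulr0 ?mul0r.
Qed.

Definition tuple_eval n m (r : 'I_m -> {mpoly K[n]}) (v : 'rV[K]_n) : 'rV[K]_m :=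
  \row_i (r i).@[v 0].

Definition tuple_comp n m (h : {mpoly K[m]}) (r : 'I_m -> {mpoly K[n]}) :
  {mpoly K[n]} := h \mPo [tuple r i | i < m].

Lemma tuple_compE n m (h : {mpoly K[m]}) (r : 'I_m -> {mpoly K[n]}) (v : 'rV[K]_n) :
  (tuple_comp h r).@[v 0] = h.@[tuple_eval r v 0].
Proof.
rewrite /tuple_comp comp_mpoly_meval; apply: meval_eq => i.
by rewrite mxE tnth_mktuple.
Qed.

Definition image_cone n m (r : 'I_m -> {mpoly K[n]}) : set 'rV[K]_m :=
  [set u | u != 0 /\ exists v, u = tuple_eval r v].

Lemma tuple_eval_neq0 n m (r : 'I_m -> {mpoly K[n]}) (v : 'rV[K]_n) i :
  (r i).@[v 0] != 0 -> tuple_eval r v != 0.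
Proof. by apply: contra => /eqP/rowP/(_ i); rewrite /tuple_eval !mxE => ->. Qed.

(** The zero vector does not belong to the cone, but as some component of r is a
nonzero polynomial, its zeros can be disregarded. *)
Lemma image_cone_vanish n m (r : 'I_m -> {mpoly K[n]}) (h : {mpoly K[m]}) :
  (exists u, image_cone r u) -> (forall u, image_cone r u -> h.@[u 0] = 0) ->
  forall v, h.@[tuple_eval r v 0] = 0.
Proof.
move=> [u [u0 [w uE]]] hr; rewrite {}uE in u0.
have [i wi] := rV0Pn _ u0; rewrite mxE in wi.
have [v|h0 v|ri0] := @meval_mul_eq0 _ _ (tuple_comp h r) (r i).
- have [->|ne] := eqVneq (r i).@[v 0] 0; first by rewrite mulr0.
  rewrite tuple_compE hr ?mul0r //; split; last by exists v.
  exact: tuple_eval_neq0 ne.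
- by rewrite -tuple_compE h0.
- by rewrite ri0 eqxx in wi.
Qed.

(** Polynomials in the parameters form a domain. *)
Lemma image_closure_irreducible n m (r : 'I_m.+1 -> {mpoly K[n]}) :
  (exists u, image_cone r u) ->
  irreducible_closed (vanishing_closure (image_cone r)).
Proof.
move=> ne; apply: vanishing_closure_irreducible.
- by case: ne => u hu; exists u => //; case: hu.
- by move=> u [].
move=> h1 h2 h12.
have [v|h|h] := @meval_mul_eq0 _ _ (tuple_comp h1 r) (tuple_comp h2 r).
- rewrite !tuple_compE -mevalM; apply: image_cone_vanish => // u hu.
  by rewrite mevalM h12.
- by left => _ [_ [v ->]]; rewrite -tuple_compE.
- by right => _ [_ [v ->]]; rewrite -tuple_compE.
Qed.

Lemma univariate_horner (q : {mpoly K[1]}) :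
  exists f : {poly K}, forall v : 'rV[K]_1, f.[v 0 0] = q.@[v 0].
Proof.
exists (mmap polyC (fun=> 'X) q) => v; rewrite /mmap horner_sum mevalE.
apply: eq_bigr => m _; rewrite hornerM hornerC /mmap1 horner_prod.
by congr (_ * _); apply: eq_bigr => i _; rewrite horner_exp hornerX ord1.
Qed.

Definition biform_form n d (p : 'M[K]_d.+1) (U0 U1 V0 V1 : {mpoly K[n]}) :=
  \sum_k \sum_l p k l *: ((U0 ^+ k * U1 ^+ (d - k)) * (V0 ^+ l * V1 ^+ (d - l))).

Lemma biform_formE n d (p : 'M[K]_d.+1) (U0 U1 V0 V1 : {mpoly K[n]})
    (v : 'rV[K]_n) :
  (biform_form p U0 U1 V0 V1).@[v 0] =
  biform p U0.@[v 0] U1.@[v 0] V0.@[v 0] V1.@[v 0].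
Proof.
rewrite raddf_sum; apply: eq_bigr => k _; rewrite raddf_sum.
by apply: eq_bigr => l _; rewrite /= mevalZ !mevalM !rmorphXn.
Qed.

Lemma biform_form_homog n d (p : 'M[K]_d.+1) (U0 U1 V0 V1 : {mpoly K[n]}) e e' :
  U0 \is e.-homog -> U1 \is e.-homog -> V0 \is e'.-homog -> V1 \is e'.-homog ->
  biform_form p U0 U1 V0 V1 \is (e * d + e' * d).-homog.
Proof.
move=> hU0 hU1 hV0 hV1; apply: rpred_sum => k _; apply: rpred_sum => l _.
have pow (A B : {mpoly K[n]}) c (i : 'I_d.+1) : A \is c.-homog -> B \is c.-homog ->
    A ^+ i * B ^+ (d - i) \is (c * d).-homog.
  move=> hA hB; have := dhomogM (dhomogMn i hA) (dhomogMn (d - i) hB).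
  by rewrite -mulnDr subnKC // -ltnS.
by rewrite dhomogZ // dhomogM // pow.
Qed.

(** Choose a line on which r is not constant.  The ratios U0 / U1 and V0 / V1 are
there functions of one variable, so they satisfy a relation.  If it failed
somewhere on the whole image, then a point of the image of the line, the closure
of the image of the line and the closure of the whole image would form a chain of
length 2 in Y. *)
Lemma curve_relation N (Y : set (projspace K N)) n (r : 'I_N.+1 -> {mpoly K[n]})
    (i j : 'I_N.+1) :
  projective_curve Y ->
  (forall u (u0 : u != 0), image_cone r u -> Y (proj_point u0)) ->
  r j != 0 -> (forall c, r i != c *: r j) ->
  forall (U0 U1 V0 V1 : {mpoly K[N.+1]}) e e',
  U0 \is e.-homog -> U1 \is e.-homog -> V0 \is e'.-homog -> V1 \is e'.-homog ->
  exists d (p : 'M[K]_d.+1), p != 0 /\ forall v : 'rV[K]_n,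
    (biform_form p U0 U1 V0 V1).@[tuple_eval r v 0] = 0.
Proof.
move=> [[S hS YE] [_ no2]] rY rj rij U0 U1 V0 V1 e e' hU0 hU1 hV0 hV1.
have [a ra] := meval_neq0 rj.
pose c := (r i).@[a 0] / (r j).@[a 0].
have [b] : exists b : 'rV[K]_n, (r i - c *: r j).@[b 0] != 0.
  by apply: meval_neq0; rewrite subr_eq0.
rewrite mevalB mevalZ => rb.
(* s is r along the line from a to b, and o is its value at a *)
pose s k : {mpoly K[1]} :=
  tuple_comp (r k) (fun l => (a 0 l)%:MP + (b 0 l - a 0 l) *: 'X_ord0).
pose o k : {mpoly K[0]} := (r k).@[a 0]%:MP.
have sE v : tuple_eval s v = tuple_eval r (a + v 0 0 *: (b - a)).
  apply/rowP => k; rewrite [LHS]mxE [RHS]mxE tuple_compE; apply: meval_eq => l.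
  by rewrite !mxE mevalD mevalC mevalZ mevalXU mulrC.
have oE v : tuple_eval o v = tuple_eval r a.
  by apply/rowP => k; rewrite [LHS]mxE [RHS]mxE mevalC.
have ra0 : tuple_eval r a != 0 by apply: tuple_eval_neq0 ra.
have rb0 : tuple_eval r b != 0.
  apply: contraNneq rb => /rowP rb0.
  by have := rb0 i; have := rb0 j; rewrite !mxE => -> ->; rewrite mulr0 subrr.
have os : image_cone o `<=` image_cone s.
  move=> u [u0 [v ->]]; rewrite oE; split=> //; exists 0.
  by rewrite sE mxE scale0r addr0.
have sr : image_cone s `<=` image_cone r.
  by move=> u [u0 [v uE]]; split=> //; rewrite uE sE; eexists.
have ne_o : exists u, image_cone o u.
  by exists (tuple_eval r a); split=> //; exists 0; rewrite oE.
have ne_s : exists u, image_cone s u by case: ne_o => u /os; exists u.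
have ne_r : exists u, image_cone r u by case: ne_s => u /sr; exists u.
have [[u0 hu0] [u1 hu1] [v0 hv0] [v1 hv1]] := And4 (univariate_horner (tuple_comp U0 s))
  (univariate_horner (tuple_comp U1 s)) (univariate_horner (tuple_comp V0 s))
  (univariate_horner (tuple_comp V1 s)).
have [d [p [p0 rel]]] := univariate_biform_relation u0 u1 v0 v1.
exists d, p; split=> //; apply: image_cone_vanish => //.
have homH := biform_form_homog p hU0 hU1 hV0 hV1.
apply: contrapT => nH; apply: no2.
exists (fun k => if k is k'.+1 then
  if k' is 0 then vanishing_closure (image_cone s)
  else vanishing_closure (image_cone r) else vanishing_closure (image_cone o)).
split.
- have rYc : vanishing_closure (image_cone r) `<=` Y.
    rewrite YE => L hL h Sh; have [dh hd] := hS h Sh; apply: (hL _ _ hd) => u hu.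
    have [u_neq0 _] := hu; have := rY u u_neq0 hu; rewrite YE => /(_ _ Sh).
    by move=> /(vanishes_at_proj_point u_neq0 hd).
  have sYc := subset_trans (vanishing_closureS sr) rYc.
  have oYc := subset_trans (vanishing_closureS os) sYc.
  by case=> [|[|[|//]]] _; split=> //; exact: image_closure_irreducible.
case=> [|[|//]] _; split; do ?exact: vanishing_closureS.
- move=> /(_ (proj_point rb0)) sub.
  have /sub/(_ ('X_i - c *: 'X_j) 1%N) : vanishing_closure (image_cone s) (proj_point rb0).
    apply: sub_vanishing_closure; split=> //; exists (const_mx 1).
    by rewrite sE mxE scale1r addrC subrK.
  have hom1 : 'X_i - c *: 'X_j \is [in K[N.+1], 1.-homog].
    by apply: rpredB; rewrite ?rpredZ // dhomogX /= mdeg1.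
  move=> /(_ hom1) h.
  have /h/(_ _ (memv_line _)) : forall u, image_cone o u -> ('X_i - c *: 'X_j).@[u 0] = 0.
    move=> _ [_ [v ->]]; rewrite oE mevalB mevalZ !mevalXU !mxE /c divfK ?subrr //.
  by rewrite mevalB mevalZ !mevalXU !mxE; apply/eqP.
- move=> sub; apply: nH => u hu; have [u_neq0 _] := hu.
  have /sub/(_ _ _ homH) := sub_vanishing_closure (u0 := u_neq0) hu.
  move=> h; apply/(vanishes_at_proj_point u_neq0 homH)/h => _ [_ [v ->]].
  rewrite biform_formE -!tuple_compE -!(hu0, hu1, hv0, hv1); exact: rel.
Qed.

(** If all the components were proportional, Y would be a single point, which
contains no chain of length 1. *)
Lemma dominant_nonconstant n N (rho : ratmap K n N) (Y : set (projspace K N)) :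
  projective_curve Y -> dominant_onto rho Y ->
  exists i j, rho j != 0 /\ forall c, rho i != c *: rho j.
Proof.
move=> [_ [[Z [irrZ ltZ]] _]] [_ dom]; apply: contrapT => const.
have [j rj] := ratmap_neq0 rho.
have /choice[c rc] : forall i, exists c, rho i = c *: rho j.
  move=> i; apply: contrapT => nc; apply: const; exists i, j; split=> // c.
  by apply/eqP => rE; apply: nc; exists c.
pose u : 'rV[K]_N.+1 := \row_i c i.
have cj : c j = 1.
  have /eqP := rc j; rewrite -subr_eq0 -{1}[rho j]scale1r -scalerBl scaler_eq0.
  by rewrite (negPf rj) orbF subr_eq0 => /eqP.
have u0 : u != 0.
  by apply/eqP => /rowP/(_ j); rewrite !mxE cj; apply/eqP; rewrite oner_eq0.
have YZ : Y `<=` vanishing_closure [set u].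
  apply: dom; first exact: vanishing_closure_closed.
  move=> L M [G rG [v [_ Gv0 GvM]]].
  have GE i : G i = c i *: G j.
    apply: (mulfI rj); have := rG i j; rewrite rc -scalerAl => <-.
    by rewrite scalerAr.
  have Gv : ratmap_eval G v = (G j).@[v 0] *: u.
    by apply/rowP => i; rewrite !mxE GE mevalZ mulrC.
  have [x [x0 ME]] := projspace_point M; move: GvM; rewrite ME => /vlineP[k Gk] h d hd hu.
  apply/(vanishes_at_proj_point x0 hd).
  have k0 : k != 0 by apply: contraNneq Gv0 => k0; rewrite Gk k0 scale0r.
  have : h.@[(k *: x) 0] = 0 by rewrite -Gk Gv (meval_dhomog_scale _ _ hd) hu // mulr0.
  by rewrite (meval_dhomog_scale _ _ hd) => /eqP; rewrite mulf_eq0 expf_eq0 (negPf k0) andbF => /eqP.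
have pt L : Y L -> L = proj_point u0.
  move=> /YZ; have [x [x0 ->]] := projspace_point L => hx.
  have prop i k : x 0 i * u 0 k = x 0 k * u 0 i.
    have hom : u 0 k *: 'X_i - u 0 i *: 'X_k \is [in K[N.+1], 1.-homog].
      by apply: rpredB; rewrite rpredZ // dhomogX /= mdeg1.
    have := hx _ _ hom; rewrite (vanishes_at_proj_point x0 hom).
    rewrite mevalB !mevalZ !mevalXU => h; apply/eqP; rewrite -subr_eq0.
    rewrite [x 0 i * _]mulrC [x 0 k * _]mulrC; apply/eqP/h => _ ->.
    by rewrite mevalB !mevalZ !mevalXU mulrC subrr.
  have xE : x = x 0 j *: u.
    by apply/rowP => i; have := prop i j; rewrite !mxE cj mulr1 => <-.
  have xj : x 0 j != 0 by apply: contraNneq (x0) => xj; rewrite xE xj scale0r.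
  apply: val_inj => /=; apply/eqP; rewrite eqEdim !dim_vline x0 u0 leqnn andbT.
  by rewrite -memvE xE memvZ // memv_line.
have [_ ] := ltZ 0%N isT; apply => L /((irrZ 1%N isT).2)/pt ->.
have [[_ [L0 ZL0] _] Z0Y] := irrZ 0%N isT.
by have /pt <- := Z0Y _ ZL0.
Qed.

End ProjectiveVarieties.

(** * The mutation in homogeneous coordinates *)

Section MutationForms.
Variable K : closedFieldType.
Implicit Types (v : 'rV[K]_3) (b : K * K) (h : {mpoly K[3]}).

Lemma tuple_comp_homog n m d e (h : {mpoly K[m]}) (r : 'I_m -> {mpoly K[n]}) :
  h \is d.-homog -> (forall i, r i \is e.-homog) -> tuple_comp h r \is (e * d).-homog.
Proof.
move=> /dhomog_mf hd hr; rewrite /tuple_comp comp_mpolyEX.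
rewrite big_seq; apply: rpred_sum => m' /hd /= <-; apply: rpredZ.
rewrite comp_mpolyX mdegE big_distrr /=.
elim/big_ind2: _ => [|p d1 q d2 hp hq|i _]; first exact: dhomog1.
  exact: dhomogM.
by rewrite tnth_mktuple; apply: dhomogMn.
Qed.

Lemma row3P v v' :
  v 0 (ix) = v' 0 (ix) -> v 0 iy = v' 0 iy -> v 0 iz = v' 0 iz -> v = v'.
Proof.
have ordE (i j : 'I_3) : val i = val j -> v 0 j = v' 0 j -> v 0 i = v' 0 i.
  by move=> /val_inj ->.
move=> ex ey ez; apply/rowP => -[[|[|[|//]]] lt];
  [apply: (ordE _ ix) | apply: (ordE _ iy) | apply: (ordE _ iz)] => //;
  by rewrite /= inordK.
Qed.

Lemma affine_rowE b : [/\ affine_row b 0 ix = b.1, affine_row b 0 iy = b.2 &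
  affine_row b 0 iz = 1].
Proof. by split; rewrite mxE inordK. Qed.

Lemma ixyz : [/\ ix != iy, ix != iz & iy != iz].
Proof. by split; rewrite -val_eqE /= !inordK. Qed.

Definition axes (i k : 'I_3) : bool :=
  (i == ix) && (k == iy) || (i == iy) && (k == ix).

Lemma axes_xy : axes ix iy.
Proof. by rewrite /axes !eqxx. Qed.

Lemma axes_yx : axes iy ix.
Proof. by rewrite /axes !eqxx orbT. Qed.

Section Elementary.
Variables (e : nat) (i k : 'I_3).

(** The substitution x_i := (1 + x_k^(-e)) / x_i of the chart z = 1, homogenized:
mu1 when (i, k) = (x, y), and mu2 when (i, k) = (y, x). *)
Definition elementary_form (l : 'I_3) : {mpoly K[3]} :=
  if l == i then ('X_k ^+ e + 'X_iz ^+ e) * 'X_iz ^+ 2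
  else if l == k then 'X_i * ('X_k * 'X_k ^+ e)
  else 'X_i * 'X_k ^+ e * 'X_iz.

Let dhomogX1 (j : 'I_3) : ('X_j : {mpoly K[3]}) \is 1.-homog := mpolyX_homog K j.

Let dhomogXn (j : 'I_3) n : ('X_j ^+ n : {mpoly K[3]}) \is n.-homog.
Proof. by have := dhomogMn n (dhomogX1 j); rewrite mul1n. Qed.

Lemma elementary_form_homog l : elementary_form l \is (e.+2).-homog.
Proof.
rewrite /elementary_form; case: eqP => _; last case: eqP => _.
- rewrite (_ : e.+2 = (e + 2)%N); last by lia.
  by apply: dhomogM; rewrite ?dhomogD.
- rewrite (_ : e.+2 = (1 + (1 + e))%N); last by lia.
  by do 2!apply: dhomogM => //.
- rewrite (_ : e.+2 = ((1 + e) + 1)%N); last by lia.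
  by do 2!apply: dhomogM => //.
Qed.

Hypothesis ik : axes i k.

Lemma elementary_evalE v : let w := tuple_eval elementary_form v in
  [/\ w 0 i = (v 0 k ^+ e + v 0 iz ^+ e) * v 0 iz ^+ 2,
      w 0 k = v 0 i * (v 0 k * v 0 k ^+ e) & w 0 iz = v 0 i * v 0 k ^+ e * v 0 iz].
Proof.
have [xy xz yz] := ixyz.
have [ne_ki ne_zi ne_zk] : [/\ k != i, iz != i & iz != k].
  by case/orP: ik => /andP[/eqP -> /eqP ->]; split; rewrite // eq_sym.
rewrite /= !mxE /elementary_form !eqxx (negPf ne_ki) (negPf ne_zi) (negPf ne_zk).
by split; rewrite !(mevalM, mevalD, rmorphXn) /= !mevalXU.
Qed.

Definition elementary_factor : {mpoly K[3]} :=
  ('X_k ^+ e + 'X_iz ^+ e) * 'X_iz ^+ 2 * ('X_i * 'X_i ^+ e)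
  * (('X_k ^+ e) ^+ e * ('X_k ^+ e) ^+ 2).

(** The substitution is an involution; clearing denominators twice leaves a common
factor. *)
Lemma elementary_involution v :
  tuple_eval elementary_form (tuple_eval elementary_form v) =
  elementary_factor.@[v 0] *: v.
Proof.
have [wi wk wz] := elementary_evalE v.
have [ti tk tz] := elementary_evalE (tuple_eval elementary_form v).
have fE : elementary_factor.@[v 0] =
    (v 0 k ^+ e + v 0 iz ^+ e) * v 0 iz ^+ 2 * (v 0 i * v 0 i ^+ e)
    * ((v 0 k ^+ e) ^+ e * (v 0 k ^+ e) ^+ 2).
  by rewrite /elementary_factor !(mevalM, mevalD, rmorphXn) /= ?(mevalM, mevalD, rmorphXn) /= !mevalXU.
have ei : tuple_eval elementary_form (tuple_eval elementary_form v) 0 i =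
    (elementary_factor.@[v 0] *: v) 0 i.
  by rewrite ti wk wz mxE fE !exprMn; set X := _ ^+ e; ring.
have ek : tuple_eval elementary_form (tuple_eval elementary_form v) 0 k =
    (elementary_factor.@[v 0] *: v) 0 k.
  by rewrite tk wk wi mxE fE !exprMn; ring.
have ez : tuple_eval elementary_form (tuple_eval elementary_form v) 0 iz =
    (elementary_factor.@[v 0] *: v) 0 iz.
  by rewrite tz wi wk wz mxE fE !exprMn; ring.
by move: ei ek; case/orP: ik => /andP[/eqP -> /eqP ->] ei ek; apply: row3P.
Qed.

Hypothesis e_gt0 : (0 < e)%N.

Lemma elementary_factor_neq0 : elementary_factor != 0.
Proof.
rewrite !mulf_neq0 ?expf_neq0 ?mpolyX_neq0 //.
have zk : iz != k by case/orP: ik => /andP[_ /eqP ->]; rewrite -val_eqE /= !inordK.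
apply/eqP => /(congr1 (meval (fun j => (j == k)%:R))).
rewrite mevalD !rmorphXn /= !mevalXU meval0 eqxx (negPf zk).
by rewrite expr1n expr0n gtn_eqF // addr0; apply/eqP; rewrite oner_eq0.
Qed.

(** A form that vanishes on the image of the map vanishes, after one more
application of the map, wherever [elementary_factor] does not. *)
Lemma elementary_dominant h d :
  h \is d.-homog -> h != 0 -> tuple_comp h elementary_form != 0.
Proof.
move=> hd h0; apply/eqP => c0.
have [v|hz|fz] := @meval_mul_eq0 _ _ h elementary_factor.
- have : (tuple_comp h elementary_form).@[tuple_eval elementary_form v 0] = 0.
    by rewrite c0 meval0.
  rewrite tuple_compE elementary_involution (meval_dhomog_scale _ _ hd) => /eqP.
  by rewrite mulf_eq0 expf_eq0 => /orP[/andP[_]|] /eqP ->; rewrite ?mulr0 ?mul0r.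
- by have [v] := meval_neq0 h0; rewrite hz eqxx.
- by have [v] := meval_neq0 elementary_factor_neq0; rewrite fz eqxx.
Qed.

End Elementary.

Lemma tuple_eval_scale n m e (r : 'I_m -> {mpoly K[n]}) (c : K) (v : 'rV[K]_n) :
  (forall i, r i \is e.-homog) -> tuple_eval r (c *: v) = c ^+ e *: tuple_eval r v.
Proof.
by move=> hr; apply/rowP => i; rewrite !mxE; exact: meval_dhomog_scale.
Qed.

Fixpoint iter_tuple n (r : 'I_n -> {mpoly K[n]}) (m : nat) : 'I_n -> {mpoly K[n]} :=
  if m is m'.+1 then fun i => tuple_comp (r i) (iter_tuple r m') else fun i => 'X_i.

Lemma iter_tupleE n (r : 'I_n -> {mpoly K[n]}) m (v : 'rV[K]_n) :
  tuple_eval (iter_tuple r m) v = iter m (tuple_eval r) v.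
Proof.
elim: m => [|m IH]; first by apply/rowP => i; rewrite mxE mevalXU.
by rewrite iterS -IH; apply/rowP => i; rewrite [LHS]mxE [RHS]mxE tuple_compE.
Qed.

Lemma iter_tuple_homog n (r : 'I_n -> {mpoly K[n]}) e m i :
  (forall i, r i \is e.-homog) -> iter_tuple r m i \is (e ^ m).-homog.
Proof.
move=> hr; elim: m i => [|m IH] i; first by rewrite dhomogX /= mdeg1.
by rewrite expnSr; apply: tuple_comp_homog.
Qed.

Lemma affine_row_of (v : 'rV[K]_3) : v 0 iz != 0 ->
  v = v 0 iz *: affine_row (v 0 ix / v 0 iz, v 0 iy / v 0 iz).
Proof.
move=> z0; have [ex ey ez] := affine_rowE (v 0 ix / v 0 iz, v 0 iy / v 0 iz).
by apply: row3P; rewrite mxE ?(ex, ey, ez) /= ?mulr1 // mulrCA divff // mulr1.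
Qed.

(** Off the zeros, in the chart z = 1, of a nonzero form. *)
Definition generically (A : K * K -> Prop) : Prop :=
  exists d h, [/\ h \is d.-homog, h != 0 & forall b, h.@[affine_row b 0] != 0 -> A b].

Lemma generically_form h d : h \is d.-homog -> h != 0 ->
  generically (fun b => h.@[affine_row b 0] != 0).
Proof. by move=> hd h0; exists d, h. Qed.

Lemma generically_and (A B : K * K -> Prop) :
  generically A -> generically B -> generically (fun b => A b /\ B b).
Proof.
move=> [d [h [hd h0 hA]]] [d' [h' [hd' h0' hB]]].
exists (d + d')%N, (h * h'); split; [exact: dhomogM | exact: mulf_neq0 |].
by move=> b; rewrite mevalM mulf_eq0 negb_or => /andP[/hA ? /hB].
Qed.

Lemma generically_imp (A B : K * K -> Prop) :
  (forall b, A b -> B b) -> generically A -> generically B.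
Proof. by move=> AB [d [h [hd h0 hA]]]; exists d, h; split=> // b /hA/AB. Qed.

(** By homogeneity, the values on the chart determine a form wherever z is nonzero;
the product with z and with the form cutting out the exceptions then vanishes. *)
Lemma generically_eq0 h d : h \is d.-homog ->
  generically (fun b => h.@[affine_row b 0] = 0) -> forall v, h.@[v 0] = 0.
Proof.
move=> hd [d' [h' [hd' h'0 hh']]].
have [v|//|hz] := @meval_mul_eq0 _ _ h (h' * 'X_iz); last first.
  have : h' * 'X_iz != 0 by rewrite mulf_neq0 // mpolyX_neq0.
  by move=> /meval_neq0[v]; rewrite hz eqxx.
rewrite mevalM mevalXU; have [->|z0] := eqVneq (v 0 iz) 0; first by rewrite !mulr0.
rewrite (affine_row_of z0); set b := (_, _).
rewrite (meval_dhomog_scale _ _ hd) (meval_dhomog_scale _ _ hd').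
have [->|/hh' ->] := eqVneq (h'.@[affine_row b 0]) 0.
  by rewrite !(mulr0, mul0r).
by rewrite mulr0 mul0r.
Qed.

Section Mutation.
Variables P Q : nat.
Hypotheses (P_gt0 : (0 < P)%N) (Q_gt0 : (0 < Q)%N).

Let m1 := @mu1 K (- Q%:Z).
Let m2 := @mu2 K (- P%:Z).
Let f z := m2 (m1 z).

Let form1 := elementary_form Q ix iy.
Let form2 := elementary_form P iy ix.

Lemma form1_affine b : in_torus b ->
  tuple_eval form1 (affine_row b) = (b.1 * b.2 ^+ Q) *: affine_row (m1 b).
Proof.
case=> b1 b2; have [vx vy vz] := affine_rowE b; have [wx wy wz] := affine_rowE (m1 b).
have [] := elementary_evalE Q axes_xy (affine_row b).
rewrite -/form1 vx vy vz => e1 e2 e3; apply: row3P; rewrite ?(e1, e2, e3) mxE ?(wx, wy, wz).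
- rewrite /m1 /mu1 /= -exprnN !expr1n mulr1 mulrC mulrA divfK //.
  by rewrite mulrDl mul1r mulVf ?expf_neq0 // addrC.
- by rewrite /m1 /mu1 /=; ring.
- by [].
Qed.

Lemma form2_affine b : in_torus b ->
  tuple_eval form2 (affine_row b) = (b.2 * b.1 ^+ P) *: affine_row (m2 b).
Proof.
case=> b1 b2; have [vx vy vz] := affine_rowE b; have [wx wy wz] := affine_rowE (m2 b).
have [] := elementary_evalE P axes_yx (affine_row b).
rewrite -/form2 vx vy vz => e1 e2 e3; apply: row3P; rewrite ?(e1, e2, e3) mxE ?(wx, wy, wz).
- by rewrite /m2 /mu2 /=; ring.
- rewrite /m2 /mu2 /= -exprnN !expr1n mulr1 mulrC mulrA divfK //.
  by rewrite mulrDl mul1r mulVf ?expf_neq0 // addrC.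
- by [].
Qed.

Definition mutation_form l := tuple_comp (form2 l) form1.

Let delta := (Q.+2 * P.+2)%N.

Lemma mutation_form_homog l : mutation_form l \is delta.-homog.
Proof.
apply: tuple_comp_homog => [|i]; exact: elementary_form_homog.
Qed.

Lemma mutation_formE v : tuple_eval mutation_form v = tuple_eval form2 (tuple_eval form1 v).
Proof. by apply/rowP => i; rewrite !mxE tuple_compE. Qed.

Definition mutation_iter n := iter_tuple mutation_form n.

(** These particular forms have no zero along a regular orbit, whereas an arbitrary
tuple of forms representing the iterate might vanish there. *)
Lemma mutation_iter_affine n b : regular P Q n b ->
  exists2 s, s != 0 & tuple_eval (mutation_iter n) (affine_row b) =
    s *: affine_row (iter n f b).
Proof.
rewrite /mutation_iter; elim: n => [|n IH] reg.
  by exists 1; [exact: oner_neq0 | rewrite iter_tupleE scale1r].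
have [|s s0 sE] := IH; first by move=> k kn; apply: reg; exact: ltnW.
have [T T1] := reg n (ltnSn n); rewrite iter_tupleE iterS -iter_tupleE sE.
rewrite (tuple_eval_scale _ _ mutation_form_homog) mutation_formE form1_affine //.
rewrite (tuple_eval_scale (e := P.+2)); last first.
  by move=> i; exact: elementary_form_homog.
rewrite form2_affine // !scalerA; eexists; last by [].
move: T T1; rewrite -/m1 -/f; move: (iter n f b) => z [z1 z2]; move: (m1 z) => y [y1 y2].
by rewrite !(expf_eq0, mulf_eq0, negb_or, negb_and) s0 z1 z2 y1 y2 !orbT.
Qed.

Lemma generically_torus : generically (fun b => in_torus b).
Proof.
apply: generically_imp (generically_and
  (generically_form (mpolyX_homog K ix) (mpolyX_neq0 K ix))
  (generically_form (mpolyX_homog K iy) (mpolyX_neq0 K iy))) => b.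
by rewrite !mevalXU; have [-> -> _] := affine_rowE b.
Qed.

(** The pullback of a nonzero form by a dominant map is a nonzero form. *)
Lemma generically_m1 A : generically A -> generically (fun b => in_torus b /\ A (m1 b)).
Proof.
move=> [d [h [hd h0 hA]]]; have hom i := elementary_form_homog Q ix iy i.
have := generically_form (tuple_comp_homog hd hom) (elementary_dominant axes_xy Q_gt0 hd h0).
move=> /(generically_and generically_torus); apply: generically_imp => b [T].
rewrite tuple_compE form1_affine // (meval_dhomog_scale _ _ hd) mulf_eq0 negb_or.
by move=> /andP[_ /hA].
Qed.

Lemma generically_m2 A : generically A -> generically (fun b => in_torus b /\ A (m2 b)).
Proof.
move=> [d [h [hd h0 hA]]]; have hom i := elementary_form_homog P iy ix i.
have := generically_form (tuple_comp_homog hd hom) (elementary_dominant axes_yx P_gt0 hd h0).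
move=> /(generically_and generically_torus); apply: generically_imp => b [T].
rewrite tuple_compE form2_affine // (meval_dhomog_scale _ _ hd) mulf_eq0 negb_or.
by move=> /andP[_ /hA].
Qed.

Lemma generically_f A : generically A ->
  generically (fun b => [/\ in_torus b, in_torus (m1 b) & A (f b)]).
Proof.
by move=> /generically_m2/generically_m1; apply: generically_imp => b [? []].
Qed.

Lemma generically_iter A n : generically A ->
  generically (fun b => regular P Q n b /\ A (iter n f b)).
Proof.
elim: n => [|n IH] hA; first by apply: generically_imp hA => b.
apply: generically_imp (generically_f (IH hA)) => b [T T1 [reg Ab]].
rewrite iterSr; split=> // -[|k] kn //.
by rewrite iterSr; exact: reg.
Qed.

End Mutation.

(** * Relations along the orbits of a fibred mutation *)

Lemma ratmap_maps_eval n m (F : ratmap K n m) (v : 'rV[K]_n.+1) (v0 : v != 0)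
    (Fv0 : ratmap_eval F v != 0) : ratmap_maps F (proj_point v0) (proj_point Fv0).
Proof.
exists F; first by move=> i j; rewrite mulrC.
by exists v; split; rewrite ?memv_line.
Qed.

Section Fibration.
Variables (P Q : nat) (mu : ratmap K 2 2).
Hypotheses (P_gt0 : (0 < P)%N) (Q_gt0 : (0 < Q)%N).
Hypothesis mu_mutation : is_mutation (- P%:Z) (- Q%:Z) mu.

Let m1 := @mu1 K (- Q%:Z).
Let m2 := @mu2 K (- P%:Z).
Let f z := m2 (m1 z).

Variables (N : nat) (Y : set (projspace K N)) (rho : ratmap K 2 N).
Variable g : projspace K N -> projspace K N.
Hypothesis fib : invariant_fibration mu Y rho g.

Let rhoA b : 'rV[K]_N.+1 := tuple_eval rho (affine_row b).

Lemma image_in_target u (u0 : u != 0) : image_cone rho u -> Y (proj_point u0).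
Proof.
have [_ [dom _] _ _] := fib.
move=> [_ [v uE]]; suff [w w0 uE'] : exists2 w, w != 0 & u = tuple_eval rho w.
  by clear uE; subst u; exact: dom (ratmap_maps_eval w0 u0).
have [v0|v0] := eqVneq v 0; last by exists v.
(* a form has a nonzero value at the origin only if it is constant *)
exists (affine_row (0, 0)); first exact: affine_row_neq0.
move: u0; rewrite uE v0 -(scale0r (affine_row (0, 0))).
rewrite (tuple_eval_scale _ _ (@ratmap_homog _ _ _ rho)) expr0n.
by case: (ratmap_deg rho == 0%N); [rewrite scale1r | rewrite scale0r eqxx].
Qed.

(** Forms represent g only locally.  But a tuple G that represents it near one point
of the image of rho represents it wherever G does not vanish, hence at the image
of a generic point. *)
Lemma semiconjugacy_tuple : exists e (G : 'I_N.+1 -> {mpoly K[N.+1]}) k,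
  [/\ forall i, G i \is e.-homog, tuple_comp (G k) rho != 0 &
  forall b, in_torus b -> in_torus (m1 b) ->
    rhoA b != 0 -> rhoA (f b) != 0 -> tuple_eval G (rhoA b) != 0 ->
    exists2 c, c != 0 & rhoA (f b) = c *: tuple_eval G (rhoA b)].
Proof.
have [j rj] := ratmap_neq0 rho; have [v rv] := meval_neq0 rj.
have rv0 : tuple_eval rho v != 0 by apply: tuple_eval_neq0 rv.
have Yv : Y (proj_point rv0) by apply: image_in_target; split=> //; exists v.
have [_ [dom _] [_ reg] inv] := fib.
have [G [[w [/vlineP[c ->] Gw _]] Gloc]] := reg _ Yv.
have hom i := ratmap_homog G i.
have {Gw} Gv : tuple_eval G (tuple_eval rho v) != 0.
  apply: contraNneq Gw => e.
  by rewrite -[ratmap_eval _ _]/(tuple_eval G _) (tuple_eval_scale _ _ hom) e scaler0.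
have [k Gk] := rV0Pn _ Gv; rewrite mxE in Gk.
exists (ratmap_deg G), G, k; split=> //.
  by apply: contraNneq Gk => e; rewrite -tuple_compE e meval0.
move=> b T T1 rb rfb Grb.
have step := inv _ _ _ _ (mu_mutation T T1) (ratmap_maps_eval (affine_row_neq0 _) rfb)
  (ratmap_maps_eval (affine_row_neq0 _) rb).
have Yb : Y (proj_point rb) by apply: image_in_target; split=> //; exists (affine_row b).
have gE : g (proj_point rb) = proj_point Grb.
  apply: Gloc => //; exists (rhoA b); split=> //; exact: memv_line.
by apply: proj_point_eqP; rewrite step -gE.
Qed.

(** The step at f^n b is generic in b since genericity can be pulled back by f^n. *)
Lemma generic_semiconjugacy e (G : 'I_N.+1 -> {mpoly K[N.+1]}) k n :
  (forall i, G i \is e.-homog) -> tuple_comp (G k) rho != 0 ->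
  (forall b, in_torus b -> in_torus (m1 b) ->
    rhoA b != 0 -> rhoA (f b) != 0 -> tuple_eval G (rhoA b) != 0 ->
    exists2 c, c != 0 & rhoA (f b) = c *: tuple_eval G (rhoA b)) ->
  generically (fun b => exists2 c, c != 0 &
    rhoA (iter n f b) = c *: iter n (tuple_eval G) (rhoA b)).
Proof.
move=> hom Gk step; have [j rj] := ratmap_neq0 rho.
have gen_rho : generically (fun b => rhoA b != 0).
  apply: generically_imp (generically_form (ratmap_homog rho j) rj) => b.
  exact: tuple_eval_neq0.
have gen_G : generically (fun b => tuple_eval G (rhoA b) != 0).
  apply: generically_imp (generically_form (tuple_comp_homog (hom k) (@ratmap_homog _ _ _ rho)) Gk).
  by move=> b; rewrite tuple_compE; exact: tuple_eval_neq0.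
elim: n => [|n IH].
  by apply: generically_imp gen_rho => b _; exists 1; rewrite ?oner_neq0 // scale1r.
have gen_step : generically (fun b => exists2 c, c != 0 &
    rhoA (f b) = c *: tuple_eval G (rhoA b)).
  apply: generically_imp (generically_and (generically_and gen_rho gen_G) (generically_f P_gt0 Q_gt0 gen_rho)).
  by move=> b [[r0 G0] [T T1 r1]]; exact: step.
apply: generically_imp (generically_and IH (generically_iter P_gt0 Q_gt0 n gen_step)).
move=> b [[c c0 cE] [_ [c' c0' cE']]].
exists (c' * c ^+ e); first by rewrite mulf_neq0 ?expf_neq0.
by rewrite !iterS cE' cE (tuple_eval_scale _ _ hom) scalerA.
Qed.

(** Let h = rho i / rho j.  For generic b, rho (f^n b) is the value at rho b of the
n-th iterate of a tuple of forms on Y, so that [curve_relation] relates h b and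
h (f^n b).  Expressing f^n by explicit forms turns the relation into the vanishing
of a form in b; it therefore extends to every regular orbit, even to one on which
the tuple representing g vanishes. *)
Lemma orbit_relation (i j : 'I_N.+1) n (c c' : K) :
  rho j != 0 -> (forall k, rho i != k *: rho j) ->
  exists d (p : 'M[K]_d.+1), p != 0 /\ forall b, regular P Q n b ->
    biform p (rho i - c *: rho j).@[affine_row b 0] (rho j).@[affine_row b 0]
      (rho i - c' *: rho j).@[affine_row (iter n f b) 0]
      (rho j).@[affine_row (iter n f b) 0] = 0.
Proof.
move=> rj rij; have [e [G [k [hom Gk step]]]] := semiconjugacy_tuple.
have semi := generic_semiconjugacy n hom Gk step.
pose U a : {mpoly K[N.+1]} := 'X_i - a *: 'X_j.
have homU a : U a \is 1.-homog by rewrite rpredB ?rpredZ ?mpolyX_homog.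
have homX : ('X_j : {mpoly K[N.+1]}) \is 1.-homog by exact: mpolyX_homog.
have homGn l := iter_tuple_homog n l hom.
have [curveY _ _ _] := fib.
have [d [p [p0 rel]]] := curve_relation curveY (fun u u0 => @image_in_target u u0) rj rij
  (homU c) homX (tuple_comp_homog (homU c') homGn) (tuple_comp_homog homX homGn).
exists d, p; split=> // b reg.
have homr a : rho i - a *: rho j \is (ratmap_deg rho).-homog.
  by rewrite rpredB ?rpredZ ?ratmap_homog.
have homF l := iter_tuple_homog n l (mutation_form_homog P Q).
have relation_at z : regular P Q n z ->
    (biform_form p (rho i - c *: rho j) (rho j)
      (tuple_comp (rho i - c' *: rho j) (mutation_iter P Q n))
      (tuple_comp (rho j) (mutation_iter P Q n))).@[affine_row z 0] = 0 <->
    biform p (rho i - c *: rho j).@[affine_row z 0] (rho j).@[affine_row z 0]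
      (rho i - c' *: rho j).@[affine_row (iter n f z) 0]
      (rho j).@[affine_row (iter n f z) 0] = 0.
  move=> /mutation_iter_affine[s s0 sE].
  rewrite biform_formE !tuple_compE sE !(meval_dhomog_scale _ _ (homr c')).
  rewrite (meval_dhomog_scale _ _ (ratmap_homog rho j)) biform_scale.
  split; last by move=> ->; rewrite mulr0.
  by move/eqP; rewrite mulf_eq0 !expf_eq0 (negPf s0) !andbF => /eqP.
apply/(relation_at b reg); apply: generically_eq0.
  exact: biform_form_homog (homr c) (ratmap_homog rho j)
    (tuple_comp_homog (homr c') homF) (tuple_comp_homog (ratmap_homog rho j) homF).
have UE a z : (rho i - a *: rho j).@[affine_row z 0] = (U a).@[rhoA z 0].
  by rewrite !(mevalB, mevalZ) !mevalXU !mxE.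
have XE z : (rho j).@[affine_row z 0] = ('X_j).@[rhoA z 0] by rewrite mevalXU mxE.
apply: generically_imp (generically_and semi (generically_iter P_gt0 Q_gt0 n generically_torus)).
move=> z [[s s0 sE] [regz _]]; apply/(relation_at z regz).
rewrite !UE !XE sE (meval_dhomog_scale _ _ (homU c')) (meval_dhomog_scale _ _ homX).
rewrite expr1 biform_scale -iter_tupleE -!tuple_compE.
have := rel (affine_row z); rewrite biform_formE -/(rhoA z) !tuple_compE => ->.
by rewrite mulr0.
Qed.

End Fibration.
End MutationForms.

(** * Absence of invariant fibrations *)

Section NoFibration.
Variable K : closedFieldType.

(** For l large, a change of m moves the second summand too much for the first one
to compensate. *)
Lemma weighted_inj (d : nat) (a b l : int) (k k' m m' : 'I_d.+1) :
  a != 0 -> b != 0 -> d%:Z * `|a| < l ->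
  k%:Z * a + l * (m%:Z * b) = k'%:Z * a + l * (m'%:Z * b) -> k = k' /\ m = m'.
Proof.
move=> a0 b0 dl e.
have e' : (k%:Z - k'%:Z) * a = l * ((m'%:Z - m%:Z) * b) by lia.
have kk : `|k%:Z - k'%:Z| <= d%:Z by have := ltn_ord k; have := ltn_ord k'; lia.
have l0 : 0 < l by apply: le_lt_trans dl; rewrite mulr_ge0.
have mm : m = m'.
  apply: val_inj; apply/eqP; apply: contraTT dl => ne; rewrite -leNgt.
  have one : 1 <= `|(m'%:Z - m%:Z) * b|.
    have : (m'%:Z - m%:Z) * b != 0 by rewrite mulf_neq0 // subr_eq0 eqz_nat eq_sym.
    by lia.
  apply: le_trans (_ : `|(k%:Z - k'%:Z) * a| <= _); last by rewrite normrM ler_wpM2r.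
  by rewrite e' normrM (gtr0_norm l0) ler_peMr // ltW.
split=> //; move: e'; rewrite mm subrr mul0r mulr0 => /eqP.
by rewrite mulf_eq0 (negPf a0) orbF subr_eq0 => /eqP[/val_inj].
Qed.

(** All the terms have distinct orders, so the one of least order survives. *)
Lemma biform_order_neq0 d (p : 'M[K]_d.+1) (a0 a1 b0 b1 : K -> K)
    (al0 al1 be0 be1 l : int) :
  p != 0 -> has_order a0 al0 -> has_order a1 al1 ->
  has_order b0 (l * be0) -> has_order b1 (l * be1) ->
  al0 != al1 -> be0 != be1 -> d%:Z * `|al0 - al1| < l ->
  ~ almost_all (fun t => biform p (a0 t) (a1 t) (b0 t) (b1 t) = 0).
Proof.
move=> p0 ha0 ha1 hb0 hb1 al be dl van.
pose z (i : 'I_d.+1 * 'I_d.+1) t := p i.1 i.2 *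
  ((a0 t ^+ i.1 * a1 t ^+ (d - i.1)) * (b0 t ^+ i.2 * b1 t ^+ (d - i.2))).
pose ord (i : 'I_d.+1 * 'I_d.+1) : int :=
  (al0 * i.1%:Z + al1 * (d - i.1)%N%:Z) + (l * be0 * i.2%:Z + l * be1 * (d - i.2)%N%:Z).
have hz i : p i.1 i.2 != 0 -> has_order (z i) (ord i).
  move=> pi; rewrite -[ord i]add0r; apply: has_order_mul.
    by exists (p i.1 i.2) => //; exact: lead_cst.
  by apply: has_order_mul; apply: has_order_mul; apply: has_order_exp.
have ordE i : ord i = (al1 * d%:Z + l * (be1 * d%:Z))
    + (i.1%:Z * (al0 - al1) + l * (i.2%:Z * (be0 - be1))).
  rewrite /ord -!subzn ?leq_ord //; ring.
have ord_inj i i' : ord i = ord i' -> i = i'.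
  rewrite !ordE => /addrI/weighted_inj[]; rewrite ?subr_eq0 //.
  by case: i i' => [k m] [k' m'] /= -> ->.
have [k0 [m0 pk]] := matrix0Pn _ p0.
pose S := [pred i : 'I_d.+1 * 'I_d.+1 | p i.1 i.2 != 0].
have [i Si min] := arg_minP ord (pk : S (k0, m0)).
have /choice[c hc] : forall i, exists c, S i -> c != 0 /\ lead (z i) (ord i) c.
  move=> i'; case: (boolP (S i')) => [/hz[c c0 lc]|_]; last by exists 0.
  by exists c.
have [ci0 _] := hc i Si.
have enumS i' : i' \in enum S -> S i' by rewrite mem_enum.
have dom : lead (fun t => \sum_(i <- enum S) z i t) (ord i) (c i).
  apply: lead_dominant; rewrite ?enum_uniq ?mem_enum //.
    by move=> i' /enumS/hc[].
  move=> i' /enumS Si' ne; rewrite lt_neqAle min // andbT.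
  by apply: contra ne => /eqP/ord_inj ->.
have [t [vt nz]] := almost_all_ex (almost_allI van (lead_neq0 ci0 dom)).
move/eqP: nz; apply; apply: etrans vt.
rewrite big_enum_cond /= /biform pair_big /= [RHS](bigID S) /=.
rewrite [X in _ = _ + X]big1 ?addr0 => [|i']; last first.
  by rewrite negbK => /eqP ->; rewrite mul0r.
by apply: eq_bigl => i'; rewrite andbT.
Qed.

Theorem mutation_no_invariant_fibration (P Q : nat) (mu : ratmap K 2 2) :
  (forall n, n.+1%:R != 0 :> K) -> (4 <= P * Q)%N ->
  is_mutation (- P%:Z) (- Q%:Z) mu -> ~ preserves_invariant_fibration mu.
Proof.
move=> char0 PQ mu_mut [N [Y [rho [g fib]]]].
have P0 : (0 < P)%N by case: (P) PQ.
have Q0 : (0 < Q)%N by case: (Q) PQ => //; rewrite muln0.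
have [curveY domY _ _] := fib.
have [i [j [rj rij]]] := dominant_nonconstant curveY domY.
have homr := ratmap_homog rho.
have [c [al [be [nb hb]]]] :=
  ratio_order (homr i) (homr j) rj rij (backward_dir_generic P0 Q0 PQ).
have [c' [al' [be' [nf hf]]]] :=
  ratio_order (homr i) (homr j) rj rij (forward_dir_generic P0 Q0 PQ).
have [w wQ] : exists w : K, w ^+ Q = - 1.
  have [w wE] := @solve_monicpoly K Q (fun k => if k is 0 then -1 else 0) Q0.
  exists w; rewrite wE -(prednK Q0) big_ord_recl /= mulr1 big1 ?addr0 // => k _.
  by rewrite mul0r.
pose n := (3 * nb + (3 * nf).+1)%N.
have [d [p [p0 rel]]] := orbit_relation P0 Q0 mu_mut fib n c c' rj rij.
have [ab hb'] := hb nb (leqnn _); have [ab' hf'] := hf nf (leqnn _).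
(* the relation, hence d, is found first; the contact order is then chosen so that
   the scale m + 1 of the forward orders exceeds d |al - be| *)
pose m := (d * `|(al nb - be nb)%R|)%N.
have [X XC [X1 X2]] := critical_backward P0 Q0 PQ wQ m nb.
have [Z CZ [Z1 Z2]] := critical_forward P0 Q0 PQ char0 wQ m nf.
have [|||hA0 hA1] := hb' 1 (fun t => (X t).1) (fun t => (X t).2); rewrite ?mul1r //.
rewrite !mul1r in hA0 hA1.
have [|||hB0 hB1] := hf' m.+1%:Z (fun t => (Z t).1) (fun t => (Z t).2) => //.
apply: (biform_order_neq0 p0 hA0 hA1 hB0 hB1 ab ab').
  by rewrite /m; lia.
apply: almost_allS (iterates_to_trans XC CZ) => t [reg <-].
by have := rel _ reg; rewrite -!surjective_pairing.
Qed.

End NoFibration.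

Theorem theoremD (R : realType) (p q : int) (mu : ratmap R[i] 2 2) :
  p <= -1 -> q <= -1 ->
  4 < p * q \/ (p = -2 /\ q = -2) ->
  is_mutation p q mu ->
  ~ preserves_invariant_fibration mu.
Proof.
move=> p1 q1 pq mu_mut.
have pE : p = - `|p|%N%:Z by lia.
have qE : q = - `|q|%N%:Z by lia.
have PQ : (4 <= `|p| * `|q|)%N by nia.
rewrite pE qE in mu_mut.
apply: mutation_no_invariant_fibration mu_mut => // n.
by rewrite pnatr_eq0.
Qed.
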